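(* Let $N,M\ge1$, $\lambda_1,\dots,\lambda_N>0$ and $\mathbf{P_C}=(p^c_{ij})\in[0,1]^{N\times M}$, and put $\lambda_C=\sum_{i=1}^N\lambda_i$ and $\lambda^*_j=\sum_{i=1}^Np^c_{ij}\lambda_i$. Consider the $N$-sensor packet arrival system described in the context and fix a process $j\in\{1,\dots,M\}$. Then, from the monitor's perspective regarding process $j$, the system is equivalent to a system with two packet sources: the packets containing information about process $j$ arrive at the server as a Poisson process of rate $\lambda^*_j$, and the packets not containing information about process $j$ arrive at the server as an independent Poisson process of rate $\lambda_C-\lambda^*_j$.
   Context: System: $N$ sensors send packets to one common server. Sensor $i$ generates packets according to a Poisson process of rate $\lambda_i$, and the Poisson processes of different sensors are independent. Each packet generated by sensor $i$ contains information about process $j$ with probability $p^c_{ij}$, independently across packets and of the generation times. From the monitor's perspective regarding process $j$, only whether a packet contains information about process $j$ matters, not which sensor generated it. A Poisson process of rate $0$ is the process with no points. *)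

(* Defs.v *)
From HB Require Import structures.
From mathcomp Require Import all_boot all_order all_algebra.
From mathcomp Require Import finmap.
From mathcomp Require Import all_classical all_reals all_analysis.
From mathcomp Require Import measurable_realfun.
Set Implicit Arguments.
Unset Strict Implicit.
Unset Printing Implicit Defensive.
Import Order.TTheory GRing.Theory Num.Theory.
Import numFieldNormedType.Exports.
Local Open Scope classical_set_scope.
Local Open Scope ring_scope.

Section independence.
Context {d : measure_display} {T : measurableType d} {R : realType}.
Variable P : probability T R.

(* The sigma-algebra sigma(X_i, i : I) on T generated by a family of maps. *)
Definition sigma_gen {I : Type} {d' : measure_display} {S : measurableType d'}
    (X : I -> T -> S) : set (set T) :=
  <<s \bigcup_(i in [set: I]) preimage_set_system setT (X i) measurable >>.

Definition mutual_indep {I : choiceType} (F : I -> set (set T)) : Prop :=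
  forall (J : {fset I}) (E : I -> set T),
    (forall i, i \in J -> F i (E i)) ->
    P (\bigcap_(i in [set` J]) E i) = (\prod_(i <- J) P (E i))%E.

Definition indep2 (F G : set (set T)) : Prop :=
  forall A B, F A -> G B -> P (A `&` B) = (P A * P B)%E.

End independence.

Section poisson_process.
Context {d : measure_display} {T : measurableType d} {R : realType}.
Variable P : probability T R.

(* N t is the number of points in [0, t].  It takes its values in \bar R, so
   that infinitely many points before time t count as +oo; the increments
   condition (with U := setT) makes this a null event.  For rate = 0,
   poisson_prob is the Dirac measure at 0, and the process has almost surely
   no points.  The argument 0 given to poisson_prob is a dummy of that
   definition. *)
Record is_poisson_process (rate : R) (N : R -> T -> \bar R) : Prop :=
  IsPoissonProcess {
    pp_rate_ge0 : 0 <= rate ;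
    pp_measurable : forall t : R, 0 <= t -> measurable_fun setT (N t) ;
    pp_start : {ae P, forall w, N 0 w = 0%E} ;
    pp_increment : forall s t : R, 0 <= s -> s <= t -> forall U : set nat,
      P [set w | exists2 n, U n & (N t w - N s w)%E = n%:R%:E] =
      poisson_prob (rate * (t - s)) 0 U ;
    pp_indep_increments : forall t : nat -> R,
      0 <= t 0%N -> (forall n, t n <= t n.+1) ->
      mutual_indep P
        (fun n : nat => sigma_gen (fun _ : unit => (N (t n.+1) \- N (t n))%E))
  }.

Definition indep_processes (N1 N2 : R -> T -> \bar R) : Prop :=
  indep2 P (sigma_gen (fun t : {t : R | 0 <= t} => N1 (val t)))
           (sigma_gen (fun t : {t : R | 0 <= t} => N2 (val t))).

(* The counting process of the packets k with k \in K w, where packet k is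
   generated at time tau k w. *)
Definition arrivals {I : choiceType} (K : T -> set I) (tau : I -> T -> R)
    (t : R) (w : T) : \bar R :=
  counting (K w `&` [set k | tau k w <= t]).

End poisson_process.

Section packet_system.
Context {d : measure_display} {T : measurableType d} {R : realType}.
Variables (P : probability T R) (N M : nat).

(* tau i k is the generation time of the k-th packet of sensor i, and
   C i k j w says whether this packet contains information about process j.  The independence
   conditions on the contents are imposed for each process j separately: the
   joint law of the contents (C i k j)_j within a packet is left arbitrary. *)
Record packet_system (lambda : 'I_N -> R) (p : 'M[R]_(N, M))
    (tau : 'I_N -> nat -> {RV P >-> R})
    (C : 'I_N -> nat -> 'I_M -> {RV P >-> bool}) : Prop := PacketSystem {
  ps_ordered : forall i k w, tau i k w <= tau i k.+1 w ;
  ps_poisson : forall i,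
    is_poisson_process P (lambda i)
      (arrivals (fun _ => [set: nat]) (fun k => tau i k)) ;
  ps_indep_sensors :
    mutual_indep P (fun i => sigma_gen (fun k => tau i k : T -> R)) ;
  ps_content : forall i k j, P [set w | C i k j w] = (p i j)%:E ;
  ps_indep_packets : forall j, mutual_indep P
    (fun q : 'I_N * nat => sigma_gen (fun _ : unit => C q.1 q.2 j : T -> bool)) ;
  ps_indep_content_times : forall j,
    indep2 P (sigma_gen (fun q : 'I_N * nat => C q.1 q.2 j : T -> bool))
             (sigma_gen (fun q : 'I_N * nat => tau q.1 q.2 : T -> R))
}.

(* The merged streams, at the server, of the packets of all sensors containing
   (resp. not containing) information about process j. *)
Definition arrivals_with (tau : 'I_N -> nat -> T -> R)
    (C : 'I_N -> nat -> 'I_M -> T -> bool) (j : 'I_M) : R -> T -> \bar R :=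
  arrivals (fun w => [set q : 'I_N * nat | C q.1 q.2 j w])
           (fun q => tau q.1 q.2).

Definition arrivals_without (tau : 'I_N -> nat -> T -> R)
    (C : 'I_N -> nat -> 'I_M -> T -> bool) (j : 'I_M) : R -> T -> \bar R :=
  arrivals (fun w => [set q : 'I_N * nat | ~~ C q.1 q.2 j w])
           (fun q => tau q.1 q.2).

End packet_system.

(* Main.v *)
Require Import Defs.
From mathcomp Require Import all_boot all_order all_algebra.
From mathcomp Require Import finmap.
From mathcomp Require Import all_classical all_reals all_analysis.
From mathcomp Require Import measurable_realfun.
From mathcomp Require Import ring.
Set Implicit Arguments.
Unset Strict Implicit.
Unset Printing Implicit Defensive.
Import Order.TTheory GRing.Theory Num.Theory.
Local Open Scope classical_set_scope.
Local Open Scope ring_scope.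

(** Fix a process j and a time grid 0 = s_0 <= s_1 <= ... <= s_m.  Since the
    generation times of a sensor are ordered, prescribing for each sensor the
    numbers of informative and of non-informative packets in every interval of
    the grid amounts to prescribing the sensor's total increments (an event
    about the times) together with the number of informative packets in
    disjoint, now deterministic, blocks of packet indices (an event about the
    contents).  By independence of times and contents the probability is a
    product of Poisson and binomial weights, which refactors as a product of
    Poisson weights with the thinned rates.  Summing over the sensors gives
    independent Poisson increments for the two merged streams on the grid, for
    both streams jointly; the independence of the two processes then follows by
    Dynkin's pi-lambda theorem applied to finite-dimensional cylinders.

    Counts are natural numbers only on the almost sure event that every sensor
    has generated no packet by time 0 and finitely many by any time. *)

(** * Probability and generated sigma-algebras *)

Section almost_sure_events.
Context {d : measure_display} {T : measurableType d} {R : realType}.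
Variable P : probability T R.

Lemma probability_setI_as (G A : set T) : measurable G -> P G = 1%E ->
  measurable A -> P (A `&` G) = P A.
Proof.
move=> mG PG mA.
have PGc : P (~` G) = 0%E by rewrite probability_setC // PG subee.
rewrite [RHS](measureDI P mA mG) [X in (X + _)%E](_ : _ = 0%E) ?add0e //.
apply/eqP; rewrite -measure_le0 -PGc; apply: le_measure; rewrite ?inE //.
- exact: measurableD.
- exact: measurableC.
Qed.

(** Used with [G := good] to replace events about the extended-real processes by events about
    natural-number counts, which describe them only almost surely. *)
Lemma eq_probability_as (G A B : set T) : measurable G -> P G = 1%E ->
  measurable A -> measurable B -> (forall w, G w -> A w <-> B w) -> P A = P B.
Proof.
move=> mG PG mA mB AB.
rewrite -(probability_setI_as mG PG mA) -(probability_setI_as mG PG mB).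
by congr (P _); apply/seteqP; split=> w [Xw Gw]; split=> //; apply/AB.
Qed.

Lemma probability_bigcap_as (F : (set T)^nat) :
  (forall n, measurable (F n)) -> (forall n, P (F n) = 1%E) ->
  P (\bigcap_n F n) = 1%E.
Proof.
move=> mF PF.
have mI : measurable (\bigcap_n F n) by exact: bigcapT_measurable.
apply/eqP; rewrite eq_le probability_le1 //=.
have PFc n : P (~` F n) = 0%E by rewrite probability_setC // PF subee.
have Pc : P (\bigcup_n ~` F n) = 0%E.
  apply/negligibleP; first by apply: bigcupT_measurable => n; exact: measurableC.
  by apply: negligible_bigcup => n; apply/negligibleP;
    [exact: measurableC|exact: PFc].
by rewrite -(setCK (\bigcap_n F n)) setC_bigcap probability_setC
  ?Pc ?sube0 //; apply: bigcupT_measurable => n; exact: measurableC.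
Qed.

Lemma probability_setI1 (A B : set T) : measurable A -> measurable B ->
  P A = 1%E -> P B = 1%E -> P (A `&` B) = 1%E.
Proof. by move=> mA mB PA PB; rewrite (probability_setI_as mB PB mA). Qed.

End almost_sure_events.

(** * Random variables with values in the natural numbers *)

Section nat_valued.
Context {d : measure_display} {T : measurableType d} {R : realType}.
Variable P : probability T R.

Lemma measurable_fun_natP (X : T -> nat) :
  measurable_fun setT X <-> (forall n, measurable (X @^-1` [set n])).
Proof.
split=> [mX n|mX _ B _]; first by rewrite -[X in measurable X]setTI; exact: mX.
rewrite setTI.
rewrite (_ : X @^-1` B = \bigcup_(n in B) (X @^-1` [set n])).
  by apply: bigcup_measurable => n _; exact: mX.
by apply/seteqP; split=> [w Bw|w [n Bn /= ->] //]; exists (X w).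
Qed.

Lemma measurable_preimage_nat (X : T -> nat) (V : set nat) :
  measurable_fun setT X -> measurable (X @^-1` V).
Proof. by move=> mX; rewrite -[X in measurable X]setTI; exact: mX. Qed.

(** Splitting along the countably many values of [X] freezes the index of [f]. This handles sums
    whose limits are random. *)
Lemma measurable_fun_nat_comp (f : nat -> T -> nat) (X : T -> nat) :
  (forall n, measurable_fun setT (f n)) -> measurable_fun setT X ->
  measurable_fun setT (fun w => f (X w) w).
Proof.
move=> mf mX; apply/measurable_fun_natP => m.
rewrite (_ : _ @^-1` _ =
  \bigcup_n (X @^-1` [set n] `&` (f n @^-1` [set m]))).
  by apply: bigcupT_measurable => n; apply: measurableI;
    exact: measurable_preimage_nat.
by apply/seteqP; split=> [w fw|w [n _ [/= -> ->]] //]; exists (X w).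
Qed.

Lemma measurable_fun_nat2 (g : nat -> nat -> nat) (X Y : T -> nat) :
  measurable_fun setT X -> measurable_fun setT Y ->
  measurable_fun setT (fun w => g (X w) (Y w)).
Proof.
move=> mX mY; apply: (@measurable_fun_nat_comp (fun n w => g n (Y w))) => // n.
by apply: (@measurable_fun_nat_comp (fun m _ => g n m)) => // m;
  exact: measurable_cst.
Qed.

Lemma measurable_fun_sumn (I : Type) (s : seq I) (X : I -> T -> nat) :
  (forall i, measurable_fun setT (X i)) ->
  measurable_fun setT (fun w => \sum_(i <- s) X i w)%N.
Proof.
move=> mX; elim: s => [|i s IH].
  by rewrite (_ : (fun _ => _) = cst 0%N) //; apply/funext => w; rewrite big_nil.
rewrite (_ : (fun _ => _) = (fun w => X i w + \sum_(i <- s) X i w)%N).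
  exact: (measurable_fun_nat2 addn).
by apply/funext => w; rewrite big_cons.
Qed.

(** Both sides are countably additive over the singletons of [V]. The event [A] carries the
    constraints on other variables, so that coordinates can be treated one at a time. *)
Lemma probability_preimage_nat (A : set T) (c : R) (X : T -> nat)
    (mu : {measure set nat -> \bar R}) :
  measurable A -> measurable_fun setT X ->
  (forall n, P (A `&` X @^-1` [set n]) = c%:E * mu [set n])%E ->
  forall V, (P (A `&` X @^-1` V) = c%:E * mu V)%E.
Proof.
move=> mA mX H V.
have VE : V = \bigcup_(n in V) [set n] by rewrite bigcup_imset1 image_id.
have tr (B : set nat) : trivIset B (fun n => [set n]).
  by move=> i j _ _ [x [-> ->]].
rewrite [in RHS]VE measure_bigcup // -nneseriesZl //.
rewrite [in LHS]VE preimage_bigcup setI_bigcupr measure_bigcup.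
- by apply: eq_eseriesr => n _; exact: H.
- by move=> n _; apply: measurableI => //; exact: measurable_preimage_nat.
- by move=> i j _ _ [x [[_ /= <-] [_ /= <-]]].
Qed.

(** [probability_preimage_nat] is applied twice: first to enlarge the singleton for [Y], then, with
    the roles exchanged, the one for [X]. *)
Lemma indep_nat_preimage (X Y : T -> nat) :
  measurable_fun setT X -> measurable_fun setT Y ->
  (forall m n, P (X @^-1` [set m] `&` Y @^-1` [set n]) =
    P (X @^-1` [set m]) * P (Y @^-1` [set n]))%E ->
  forall V W, (P (X @^-1` V `&` Y @^-1` W) = P (X @^-1` V) * P (Y @^-1` W))%E.
Proof.
move=> mX mY H V W.
have fin A : measurable A -> (fine (P A))%:E = P A.
  by move=> mA; rewrite fineK // fin_num_measure.
have H1 m : forall W, (P (X @^-1` [set m] `&` Y @^-1` W) =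
    P (X @^-1` [set m]) * P (Y @^-1` W))%E.
  move=> B; rewrite -(fin (X @^-1` [set m])); last exact: measurable_preimage_nat.
  rewrite (@probability_preimage_nat _ (fine (P (X @^-1` [set m]))) _
    (pushforward P Y)) //; first exact: measurable_preimage_nat.
  by move=> n; rewrite H fin //; exact: measurable_preimage_nat.
rewrite setIC muleC -(fin (Y @^-1` W)); last exact: measurable_preimage_nat.
rewrite (@probability_preimage_nat _ (fine (P (Y @^-1` W))) _
    (pushforward P X)) //; first exact: measurable_preimage_nat.
move=> n; rewrite setIC H1 [LHS]muleC; congr (_ * _)%E.
by rewrite fineK //; exact/fin_num_measure/measurable_preimage_nat.
Qed.

End nat_valued.

(** * Cylinders, generated sigma-algebras and the pi-lambda argument *)

Fixpoint cylinder {I T S : Type} (X : I -> T -> S) (cs : seq (I * set S)) :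
    set T :=
  if cs is c :: cs' then X c.1 @^-1` c.2 `&` cylinder X cs' else setT.

Lemma cylinder_comp {I : eqType} {T T' S : Type} (ts : seq I) (X : I -> T -> S)
    (Y : I -> T' -> S) (f : T -> T') (w : T) cs :
  (forall t, t \in ts -> X t w = Y t (f w)) ->
  all (fun c => c.1 \in ts) cs -> cylinder X cs w = cylinder Y cs (f w).
Proof.
move=> XY; elim: cs => //= c cs IH /andP[cts /IH csE].
by rewrite /setI /mkset /= csE XY.
Qed.

Section generated_sigma_algebras.
Context {d : measure_display} {T : measurableType d} {R : realType}.
Variable P : probability T R.

(** For fixed [B], the measurable sets [A] satisfying the product formula form a Dynkin system, and
    it contains the pi-system [G1]. *)
Lemma indep2_lambda (G1 : set (set T)) (B : set T) :
  G1 `<=` measurable -> setI_closed G1 -> measurable B ->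
  (forall A, G1 A -> P (A `&` B) = P A * P B)%E ->
  forall A, <<s G1 >> A -> (P (A `&` B) = P A * P B)%E.
Proof.
move=> mG IG mB H.
pose L := [set A | measurable A /\ (P (A `&` B) = P A * P B)%E].
have fB : P B \is a fin_num by exact: fin_num_measure.
suff dL : dynkin L.
  move=> A; rewrite -setI_closed_g_dynkin_g_sigma_algebra // => /(_ L) [] //.
  by split=> // C GC; split; [exact: mG|exact: H].
split.
- by split=> //; rewrite setTI probability_setT mul1e.
- move=> A [mA HA]; split; first exact: measurableC.
  have fA : P A \is a fin_num by exact: fin_num_measure.
  rewrite probability_setC // muleBl ?fin_num_adde_defr // mul1e -HA.
  rewrite setIC -setDE measureD //; last by rewrite ltey_eq fB.
  by rewrite setIC.
- move=> F tF LF; have mF n : measurable (F n) by have [] := LF n.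
  split; first exact: bigcupT_measurable.
  rewrite setI_bigcupl !measure_bigcup //.
  + rewrite muleC -(fineK fB) -nneseriesZl //.
    by apply: eq_eseriesr => n _; rewrite (fineK fB) muleC; have [] := LF n.
  + by move=> n _; exact: measurableI.
  + by move=> i j _ _ [x [[Fi _] [Fj _]]]; apply: tF => //; exists x.
Qed.

(** Each factor is extended in turn: from [G1] to its sigma-algebra against a fixed set of [G2],
    then from [G2] against a fixed set of the first sigma-algebra. *)
Lemma indep2_generated (G1 G2 : set (set T)) :
  G1 `<=` measurable -> G2 `<=` measurable ->
  setI_closed G1 -> setI_closed G2 ->
  indep2 P G1 G2 -> indep2 P <<s G1 >> <<s G2 >>.
Proof.
move=> mG1 mG2 I1 I2 H A B sA sB.
have mA : measurable A.
  by move: A sA; apply: smallest_sub => //; exact: sigma_algebra_measurable.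
rewrite setIC muleC; apply: (indep2_lambda mG2) => // C GC.
rewrite setIC muleC; apply: (indep2_lambda mG1) => //; first exact: mG2.
by move=> D GD; exact: H.
Qed.

Lemma indep2_sub (F F' G G' : set (set T)) : F' `<=` F -> G' `<=` G ->
  indep2 P F G -> indep2 P F' G'.
Proof. by move=> FF GG H A B /FF FA /GG GB; exact: H. Qed.

Section families.
Context {I : Type} {d' : measure_display} {S : measurableType d'}.
Implicit Type X : I -> T -> S.

Lemma sigma_gen_preimage X i B : measurable B -> sigma_gen X (X i @^-1` B).
Proof.
move=> mB; apply: sub_gen_smallest; exists i => //; exists B => //.
by rewrite setTI.
Qed.

Lemma sigma_gen_min X (H : set (set T)) : sigma_algebra setT H ->
  (forall i B, measurable B -> H (X i @^-1` B)) -> sigma_gen X `<=` H.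
Proof.
move=> sH HX; apply: smallest_sub => // _ [i _ [B mB <-]].
by rewrite setTI; exact: HX.
Qed.

Lemma sigma_gen_measurable X : (forall i, measurable_fun setT (X i)) ->
  sigma_gen X `<=` measurable.
Proof.
move=> mX; apply: sigma_gen_min; first exact: sigma_algebra_measurable.
by move=> i B mB; rewrite -[X in measurable X]setTI; exact: mX.
Qed.

Lemma sigma_gen_algebra X : sigma_algebra setT (sigma_gen X).
Proof. exact: smallest_sigma_algebra. Qed.

Definition measurable_constraints (cs : seq (I * set S)) : Prop :=
  foldr (fun c Q => measurable c.2 /\ Q) True cs.

Definition cylinders X : set (set T) :=
  [set cylinder X cs | cs in measurable_constraints].

Lemma cylinder_cat X cs1 cs2 :
  cylinder X (cs1 ++ cs2) = cylinder X cs1 `&` cylinder X cs2.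
Proof. by elim: cs1 => [|c cs IH] /=; rewrite ?setTI // IH setIA. Qed.

(** A list of constraints may repeat an index, so intersecting two cylinders is mere
    concatenation. *)
Lemma setI_closed_cylinders X : setI_closed (cylinders X).
Proof.
move=> _ _ [cs1 m1 <-] [cs2 m2 <-]; exists (cs1 ++ cs2).
  by elim: cs1 m1 => //= c cs IH [mc mcs]; split=> //; exact: IH.
exact: cylinder_cat.
Qed.

Lemma cylinders_measurable X : (forall i, measurable_fun setT (X i)) ->
  cylinders X `<=` measurable.
Proof.
move=> mX _ [cs mcs <-]; elim: cs mcs => [|c cs IH] /= => [_|[mc mcs]].
  exact: measurableT.
apply: measurableI; last exact: IH.
by rewrite -[X in measurable X]setTI; exact: mX.
Qed.

Lemma sigma_gen_cylinders X : sigma_gen X `<=` <<s cylinders X >>.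
Proof.
apply: sigma_gen_min => [|i B mB]; first exact: smallest_sigma_algebra.
by apply: sub_gen_smallest; exists [:: (i, B)] => //=; rewrite setIT.
Qed.

End families.

(** The preimages under a single map already form a sigma-algebra, so generation adds no further
    sets. *)
Lemma sigma_gen_unit {d' : measure_display} {S : measurableType d'}
    (X : T -> S) (E : set T) : sigma_gen (fun _ : unit => X) E ->
  exists2 B, measurable B & E = X @^-1` B.
Proof.
pose H := preimage_set_system setT X measurable.
have sH : sigma_algebra setT H.
  exact/sigma_algebra_preimage/sigma_algebra_measurable.
have: sigma_gen (fun _ : unit => X) `<=` H.
  by apply: sigma_gen_min => // _ B mB; exists B => //; rewrite setTI.
by move=> /[apply] -[B mB <-]; exists B => //; rewrite setTI.
Qed.

End generated_sigma_algebras.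

(** * Closure properties of sigma-algebras *)

Section sigma_algebra_closure.
Context {T : Type}.
Variable H : set (set T).
Hypothesis sH : sigma_algebra setT H.

Lemma sigma_algebra_setC A : H A -> H (~` A).
Proof. by move=> HA; rewrite -setTD; case: sH => _ + _; apply. Qed.

Lemma sigma_algebra_bigcapn (F : (set T)^nat) :
  (forall n, H (F n)) -> H (\bigcap_n F n).
Proof.
move=> HF; rewrite -(setCK (\bigcap_n F n)) setC_bigcap.
apply: sigma_algebra_setC; case: sH => _ _; apply=> n.
exact: sigma_algebra_setC.
Qed.

Lemma sigma_algebra_setT : H setT.
Proof. by rewrite -setC0; apply: sigma_algebra_setC; case: sH. Qed.

Lemma sigma_algebra_bigcap_count (J : countType) (F : J -> set T) :
  (forall i, H (F i)) -> H [set w | forall i, F i w].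
Proof.
move=> HF; pose F' n := oapp F setT (choice.unpickle n).
rewrite (_ : [set w | _] = \bigcap_n F' n).
  apply: sigma_algebra_bigcapn => n; rewrite /F'.
  by case: choice.unpickle => // ; exact: sigma_algebra_setT.
apply/seteqP; split=> w Fw.
  by move=> n _; rewrite /F'; case: choice.unpickle.
by move=> i; have := Fw (choice.pickle i) I; rewrite /F' choice.pickleK.
Qed.

Lemma sigma_algebra_bigcap_seq (J : eqType) (s : seq J) (F : J -> set T) :
  (forall i, i \in s -> H (F i)) -> H [set w | forall i, i \in s -> F i w].
Proof.
elim: s => [|i s IH] HF.
  by rewrite (_ : [set w | _] = setT); [exact: sigma_algebra_setT|apply/seteqP].
pose G n := if n is 0%N then F i else [set w | forall i, i \in s -> F i w].
rewrite (_ : [set w | _] = \bigcap_n G n).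
  apply: sigma_algebra_bigcapn => -[|n] /=; first by apply: HF; rewrite mem_head.
  by apply: IH => k ks; apply: HF; rewrite inE ks orbT.
apply/seteqP; split=> w Fw.
  move=> [|n] _ /=; first by apply: Fw; rewrite mem_head.
  by move=> k ks; apply: Fw; rewrite inE ks orbT.
move=> k; rewrite inE => /orP[/eqP ->|]; first exact: (Fw 0%N I).
exact: (Fw 1%N I).
Qed.

End sigma_algebra_closure.

(** The sigma-algebra is abstract because two instances are used: all measurable sets, and the
    sigma-algebra generated by the packet contents. *)
Lemma sigma_algebra_block_eq {T : Type} (I : eqType) (X : I -> T -> nat)
    (H : set (set T)) : sigma_algebra setT H ->
  (forall x n, H (X x @^-1` [set n])) ->
  forall bl : seq (seq I * nat),
  H [set w | all (fun r => \sum_(x <- r.1) X x w == r.2)%N bl].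
Proof.
move=> sH HX; have Hsum s m : H [set w | (\sum_(x <- s) X x w)%N = m].
  elim: s m => [|x s IH] m.
    have [m0|m0] := eqVneq 0%N m.
      rewrite (_ : [set w | _] = setT); first exact: sigma_algebra_setT.
      by apply/seteqP; split=> w //= _; rewrite big_nil.
    rewrite (_ : [set w | _] = set0); first by case: sH.
    by apply/seteqP; split=> w //=; rewrite big_nil => /eqP; rewrite (negbTE m0).
  (* The union over the value [k] of the first summand, written with complements and a countable
     intersection. *)
  rewrite (_ : [set w | _] = ~` \bigcap_k ~` (X x @^-1` [set k] `&`
      [set w | (k + \sum_(y <- s) X y w)%N = m])).
    apply: (sigma_algebra_setC sH); apply: (sigma_algebra_bigcapn sH) => k.
    apply: (sigma_algebra_setC sH).
    have HI A A' : H A -> H A' -> H (A `&` A').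
      move=> HA HA'; rewrite (_ : _ `&` _ =
          [set w | forall b : bool, (if b then A else A') w]).
        apply: (sigma_algebra_bigcap_count sH
          (F := fun b : bool => if b then A else A')).
        by case.
      apply/seteqP; split=> w; first by move=> [Aw A'w] [].
      by move=> Aw; split; [exact: (Aw true)|exact: (Aw false)].
    apply: HI => //; have [km|mk] := leqP k m.
      rewrite (_ : [set w | _] = [set w | (\sum_(y <- s) X y w)%N = (m - k)%N]) //.
      apply/seteqP; split=> w /=; first by move=> <-; rewrite addKn.
      by move=> ->; rewrite subnKC.
    rewrite (_ : [set w | _] = set0); first by case: sH.
    apply/seteqP; split=> w //= km; move: mk; rewrite -km ltnNge leq_addr //.
  rewrite setC_bigcap; apply/seteqP; split=> w /=.
    by rewrite big_cons => xm; exists (X x w) => //; rewrite setCK.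
  by move=> [k _]; rewrite setCK big_cons => -[/= ->].
elim=> [|r bl IH].
  by rewrite (_ : [set w | _] = setT); [exact: sigma_algebra_setT|apply/seteqP].
rewrite (_ : [set w | _] = [set w | forall b : bool,
  (if b then [set w | (\sum_(x <- r.1) X x w)%N = r.2] else
   [set w | all (fun r => \sum_(x <- r.1) X x w == r.2)%N bl]) w]).
  apply: (sigma_algebra_bigcap_count sH (F := fun b : bool => if b then _ else _)).
  by case.
apply/seteqP; split=> w /=; first by move=> /andP[/eqP rw blw] [].
by move=> bw; rewrite (bw false) andbT; apply/eqP; exact: (bw true).
Qed.

(** * Block sums of independent counts *)

Section poisson_weights.
Context {R : realType}.
Implicit Types (mu p : R) (n m : nat).

(* Unlike poisson_pmf, which is 1 at every n when mu = 0. *)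
Definition pois mu n : R := mu ^+ n * n`!%:R^-1 * expR (- mu).

Lemma pois0 n : pois 0 n = (n == 0%N)%:R.
Proof.
rewrite /pois oppr0 expR0 mulr1 expr0n; case: n => [|n] /=.
  by rewrite fact0 invr1 mulr1.
by rewrite mul0r.
Qed.

Lemma poisson_prob_set1 mu n : 0 <= mu ->
  poisson_prob mu 0 [set n] = (pois mu n)%:E.
Proof.
rewrite le_eqVlt => /orP[/eqP <-|mu0]; rewrite /poisson_prob.
  rewrite ltxx diracE pois0.
  case: n => [|n] /=; first by rewrite mem_set.
  by rewrite memNset.
by rewrite mu0 esum_set1 /poisson_pmf ?mu0 // lee_fin !mulr_ge0
  ?exprn_ge0 ?expR_ge0 // ltW.
Qed.

Lemma poisD mu nu n :
  pois (mu + nu) n = \sum_(k < n.+1) pois mu k * pois nu (n - k)%N.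
Proof.
rewrite /pois addrC exprDn opprD expRD !mulr_suml; apply: eq_bigr => k _.
have kn : (k <= n)%N by rewrite -ltnS.
have n0 l : l`!%:R != 0 :> R by rewrite pnatr_eq0 -lt0n fact_gt0.
have -> : n`!%:R = 'C(n, k)%:R * (k`!%:R * (n - k)`!%:R) :> R.
  by rewrite -(bin_fact kn) !natrM.
have C0 : 'C(n, k)%:R != 0 :> R by rewrite pnatr_eq0 -lt0n bin_gt0.
rewrite -mulr_natr; field; rewrite ?n0 ?C0 //.
Qed.

(** The thinning identity: a Poisson total with a binomial split has the law of two independent
    Poisson counts. The factorial of [m + n] cancels against the binomial coefficient, and the
    powers and the exponential split. *)
Lemma pois_thin mu p m n :
  pois mu (m + n) * ('C(m + n, m)%:R * p ^+ m * (1 - p) ^+ n) =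
  pois (p * mu) m * pois ((1 - p) * mu) n.
Proof.
have n0 l : l`!%:R != 0 :> R by rewrite pnatr_eq0 -lt0n fact_gt0.
have := bin_fact (leq_addr n m); rewrite addKn => mnE.
have mnR : (m + n)`!%:R = 'C(m + n, m)%:R * (m`!%:R * n`!%:R) :> R.
  by rewrite -mnE !natrM.
have C0 : 'C(m + n, m)%:R != 0 :> R by rewrite pnatr_eq0 -lt0n bin_gt0 leq_addr.
rewrite /pois mnR.
have -> : - mu = - (p * mu) + - ((1 - p) * mu) by ring.
rewrite expRD !exprMn exprD; field; rewrite ?n0 ?C0 //.
Qed.

Definition bern p n : R := if n is k.+1 then (k == 0%N)%:R * p else 1 - p.

End poisson_weights.

Section convolution.
Context {R : realType} {I : Type}.
Implicit Types (g : I -> nat -> R) (s : seq I).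

(* The law of a sum of independent variables indexed by s, x having law g x. *)
Fixpoint conv g s m : R :=
  if s is x :: s' then \sum_(k < m.+1) g x k * conv g s' (m - k)%N
  else (m == 0%N)%:R.

Lemma conv_pois (mu : I -> R) s m :
  conv (fun x => pois (mu x)) s m = pois (\sum_(x <- s) mu x) m.
Proof.
elim: s m => [|x s IH] m /=; first by rewrite big_nil pois0.
rewrite big_cons poisD; apply: eq_bigr => k _; rewrite IH. by [].
Qed.

(** A sum of independent Bernoulli variables is binomial; the induction step is Pascal's rule. *)
Lemma conv_bern (p : R) s m :
  conv (fun _ => bern p) s m = 'C(size s, m)%:R * p ^+ m * (1 - p) ^+ (size s - m).
Proof.
elim: s m => [|x s IH] m /=.
  by case: m => [|m] /=; rewrite ?bin0 ?bin0n /= ?mul0r ?expr0 ?mulr1.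
rewrite big_ord_recl /= subn0 IH; case: m => [|m].
  rewrite big_ord0 !bin0 addr0 !subn0 exprS expr0; ring.
rewrite big_ord_recl /= big1 ?addr0; last by move=> i _; rewrite !mul0r.
rewrite mul1r IH subSS (_ : m.+1 - bump 0 0 = m)%N ?binS ?natrD; last first.
  by rewrite /bump subn1.
(* If [m < size s], the exponent [size s - m] is a successor and absorbs the factor [1 - p].
   Otherwise the subtraction truncates, but the coefficient in front vanishes. *)
have [ms|sm] := ltnP m (size s).
  by rewrite -(subnSK ms) !exprS; ring.
rewrite (@bin_small (size s) m.+1) ?ltnS // mulr0n exprS; ring.
Qed.

End convolution.

Lemma conv_map {R : realType} (I J : Type) (f : J -> I) (g : I -> nat -> R)
    (s : seq J) m :
  conv g (map f s) m = conv (fun y => g (f y)) s m.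
Proof. by elim: s m => //= y s IH m; apply: eq_bigr => k _; rewrite IH. Qed.

(** * Joint laws of sums over disjoint blocks of independent variables *)

Section block_sums.
Context {d : measure_display} {T : measurableType d} {R : realType}.
Variable P : probability T R.
Context {I : eqType}.
Variable X : I -> T -> nat.
Hypothesis mX : forall x, measurable_fun setT (X x).
Implicit Types (s xs : seq I) (a : I -> nat) (bl : seq (seq I * nat)).

Definition joint_eq xs a : set T := [set w | all (fun x => X x w == a x) xs].

Definition block_eq bl : set T :=
  [set w | all (fun r => \sum_(x <- r.1) X x w == r.2)%N bl].

Lemma measurable_joint_eq xs a : measurable (joint_eq xs a).
Proof.
elim: xs => [|x xs IH].
  by rewrite (_ : joint_eq _ _ = setT) //; apply/seteqP; split.
rewrite (_ : joint_eq _ _ = X x @^-1` [set a x] `&` joint_eq xs a).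
  by apply: measurableI => //; exact: measurable_preimage_nat.
apply/seteqP; split=> w; rewrite /joint_eq /=; first by move=> /andP[/eqP].
by move=> [-> ->]; rewrite eqxx.
Qed.

Lemma measurable_block_eq bl : measurable (block_eq bl).
Proof.
apply: (sigma_algebra_block_eq (@sigma_algebra_measurable _ T)) => x n.
exact: measurable_preimage_nat.
Qed.

(** Moves [x] from the first block to the individually prescribed variables, by cases on its value
    [k]. Since [x] is not in [xs], redefining [a] at [x] changes no earlier constraint. *)
Lemma joint_eq_block_eq_cons x s m bl xs a :
  x \notin xs ->
  joint_eq xs a `&` block_eq ((x :: s, m) :: bl) =
  \big[setU/set0]_(k < m.+1)
    (joint_eq (x :: xs) [eta a with x |-> k : nat] `&` block_eq ((s, (m - k)%N) :: bl)).
Proof.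
move=> xxs.
have aE (k : nat) w : all (fun y => X y w == [eta a with x |-> k] y) xs =
    all (fun y => X y w == a y) xs.
  by apply: eq_in_all => y yxs /=; case: (y =P x) => // yx; move: xxs; rewrite -yx yxs.
rewrite -(bigcup_mkord m.+1 (fun k => joint_eq (x :: xs) [eta a with x |-> k] `&`
  block_eq ((s, (m - k)%N) :: bl))).
apply/seteqP; split=> w; rewrite /joint_eq /block_eq /=.
  move=> [Xa /andP[/eqP sm sbl]]; rewrite big_cons in sm.
  exists (X x w); first by rewrite /= ltnS -sm leq_addr.
  by rewrite /= aE Xa sbl !eqxx -sm addKn eqxx.
move=> [k /= km]; rewrite aE eqxx => -[/andP[/eqP Xk ->] /andP[/eqP sm ->]].
by split=> //; rewrite big_cons Xk sm subnKC ?eqxx // -ltnS.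
Qed.

(** The blocks are emptied one index at a time into [xs], each move being a finite disjoint union
    that unfolds one convolution step. When no block is left, the hypothesis on [s0] applies. *)
Lemma probability_block_sums (g : I -> nat -> R) s0 : uniq s0 ->
  (forall a, P (joint_eq s0 a) = (\prod_(x <- s0) g x (a x))%:E) ->
  forall bl xs a, perm_eq (xs ++ flatten (unzip1 bl)) s0 ->
  P (joint_eq xs a `&` block_eq bl) =
    (\prod_(x <- xs) g x (a x) * \prod_(r <- bl) conv g r.1 r.2)%:E.
Proof.
move=> us0 H; elim=> [|[s m] bl IH] xs a.
  rewrite /= cats0 => xs0; rewrite big_nil mulr1 (perm_big _ xs0) -H.
  congr (P _); apply/seteqP; split=> w; rewrite /joint_eq /block_eq /=.
    by move=> [+ _]; rewrite (perm_all _ xs0).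
  by rewrite (perm_all _ xs0).
rewrite big_cons /=; elim: s xs m a => [|x s IHs] xs m a xs0.
  rewrite /=; case: (eqVneq m 0%N) => [->|m0].
    rewrite mul1r -IH //; congr (P _); apply/seteqP.
    by split=> w; rewrite /joint_eq /block_eq /= big_nil eqxx.
  rewrite mul0r mulr0 (_ : _ `&` _ = set0) ?measure0 //; apply/seteqP.
  split=> w // -[_]; rewrite /block_eq /= big_nil => /andP[/eqP m0'].
  by rewrite -m0' eqxx in m0.
have xxs : x \notin xs.
  move: us0; rewrite -(perm_uniq xs0) cat_uniq /= => /and3P[_ /norP[]] //.
have mF (k : 'I_m.+1) : measurable (joint_eq (x :: xs) [eta a with x |-> k : nat]
    `&` block_eq ((s, (m - k)%N) :: bl)).
  by apply: measurableI; [exact: measurable_joint_eq|exact: measurable_block_eq].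
rewrite joint_eq_block_eq_cons // measure_bigsetU_ord //; last first.
  move=> i j _ _ [w [[+ _] [+ _]]].
  rewrite /joint_eq /= !eqxx => /andP[/eqP Xi _] /andP[/eqP Xj _].
  by apply: ord_inj; rewrite -Xi.
rewrite /= mulr_suml mulr_sumr -sumEFin; apply: eq_bigr => k _.
rewrite IHs; last by rewrite -(permPr xs0) perm_sym -(cat1s x s) -catA perm_catCA.
rewrite big_cons /= eqxx; congr _%:E.
rewrite (@eq_big_seq _ _ _ _ _ _ (fun y => g y (a y))); first by ring.
by move=> y yxs /=; case: (y =P x) => // yx; move: xxs; rewrite -yx yxs.
Qed.

(** The indices in [xs] still have prescribed values while those in [ys] range over sets;
    [probability_preimage_nat] transfers one index from the first kind to the second. *)
Lemma probability_joint_preimage (mu : I -> probability nat R) s0 : uniq s0 ->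
  (forall a, P (joint_eq s0 a) = (\prod_(x <- s0) fine (mu x [set a x]))%:E) ->
  forall (U : I -> set nat) ys xs a, perm_eq (xs ++ ys) s0 ->
  P (joint_eq xs a `&` [set w | forall x, x \in ys -> U x (X x w)]) =
    (\prod_(x <- xs) fine (mu x [set a x]) *
     \prod_(x <- ys) fine (mu x (U x)))%:E.
Proof.
move=> us0 H U.
have mS (ys : seq I) : measurable [set w | forall x, x \in ys -> U x (X x w)].
  rewrite (_ : [set w | _] = \bigcap_(x in [set` ys]) (X x @^-1` U x)).
    apply: fin_bigcap_measurable. exact: finite_seq.
    by move=> x _; exact: measurable_preimage_nat.
  by apply/seteqP; split.
elim=> [|y ys IH] xs a.
  rewrite cats0 => xs0; rewrite big_nil mulr1 (perm_big _ xs0) -H.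
  congr (P _); apply/seteqP; split=> w; rewrite /joint_eq /=.
    by move=> [+ _]; rewrite (perm_all _ xs0).
  by rewrite (perm_all _ xs0); split.
move=> xs0; set A := joint_eq xs a.
set B := [set w | forall x, x \in ys -> U x (X x w)].
have yxs : y \notin xs.
  by move: us0; rewrite -(perm_uniq xs0) cat_uniq /= => /and3P[_ /norP[]].
rewrite (_ : A `&` _ = (A `&` B) `&` (X y @^-1` U y)); last first.
  apply/seteqP; split=> w.
    move=> [Aw Bw]; split; last by apply: Bw; rewrite mem_head.
    by split=> // x xys; apply: Bw; rewrite inE xys orbT.
  move=> [[Aw Bw] Uw]; split=> // x; rewrite inE => /orP[/eqP ->//|xys].
  exact: Bw.
set c := \prod_(x <- xs) fine (mu x [set a x]) * \prod_(x <- ys) fine (mu x (U x)).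
have fmu B' : exists r, mu y B' = r%:E.
  by exists (fine (mu y B')); rewrite fineK // fin_num_measure.
have HA n : (P (A `&` B `&` X y @^-1` [set n]) = c%:E * mu y [set n])%E.
  pose a' := [eta a with y |-> n].
  rewrite (_ : _ `&` _ = joint_eq (y :: xs) a' `&` B).
    rewrite IH; last by rewrite -(permPr xs0) perm_sym -(cat1s y ys) perm_catCA.
    have [r rE] := fmu [set n].
    rewrite big_cons /= eqxx rE -EFinM; congr _%:E; rewrite /c /=.
    rewrite (@eq_big_seq _ _ _ _ _ _ (fun x => fine (mu x [set a x]))); first by ring.
    by move=> x xxs /=; case: (x =P y) => // xy; move: yxs; rewrite -xy xxs.
  have aE w : all (fun x => X x w == a' x) xs = all (fun x => X x w == a x) xs.
    apply: eq_in_all => x xxs /=; case: (x =P y) => // xy.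
    by move: yxs; rewrite -xy xxs.
  apply/seteqP; split=> w; rewrite /A /joint_eq /= aE eqxx.
    by move=> [[-> Bw] ->]; rewrite eqxx.
  by move=> [/andP[/eqP -> ->]].
rewrite (@probability_preimage_nat _ _ _ P _ c _ (mu y)) //; last first.
  by apply: measurableI; [exact: measurable_joint_eq|exact: mS].
have [r rE] := fmu (U y).
rewrite big_cons rE; transitivity (c%:E * r%:E)%E; first by congr (_ * _)%E.
by rewrite -EFinM; congr _%:E; rewrite /c /=; ring.
Qed.

End block_sums.

(** * Countable intersections and finite families of independent events *)

Section countable_intersections.
Context {d : measure_display} {T : measurableType d} {R : realType}.
Variable P : probability T R.

Lemma measurable_bigcap_count (J : countType) (F : J -> set T) :
  (forall i, measurable (F i)) -> measurable [set w | forall i, F i w].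
Proof.
move=> mF; apply: (@sigma_algebra_bigcap_count _ measurable) => //.
exact: sigma_algebra_measurable.
Qed.

Lemma probability_bigcap_count (J : countType) (F : J -> set T) :
  (forall i, measurable (F i)) -> (forall i, P (F i) = 1%E) ->
  P [set w | forall i, F i w] = 1%E.
Proof.
move=> mF PF; pose F' n := oapp F setT (choice.unpickle n).
rewrite (_ : [set w | _] = \bigcap_n F' n).
  apply: probability_bigcap_as => n; rewrite /F'.
    by case: choice.unpickle => [i|] /=; [exact: mF|exact: measurableT].
  by case: choice.unpickle => [i|] /=; [exact: PF|exact: probability_setT].
apply/seteqP; split=> w Fw.
  by move=> n _; rewrite /F'; case: choice.unpickle.
by move=> i; have := Fw (choice.pickle i) I; rewrite /F' choice.pickleK.
Qed.

Lemma mutual_indep_seq (I : choiceType) (F : I -> set (set T)) :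
  mutual_indep P F -> forall (s : seq I) (E : I -> set T), uniq s ->
  (forall i, i \in s -> F i (E i)) ->
  P [set w | forall i, i \in s -> E i w] = (\prod_(i <- s) P (E i))%E.
Proof.
move=> indF s E us FE; have := indF (seq_fset tt s) E.
rewrite (perm_big _ (seq_fset_perm tt s)) /= undup_id // => <-.
  congr (P _); apply/seteqP; split=> w Ew i /= si.
    by apply: Ew; rewrite -(seq_fsetE tt).
  by apply: Ew; move: si; rewrite -(seq_fsetE tt).
by move=> i si; apply: FE; rewrite -(seq_fsetE tt).
Qed.

Lemma measurable_eq_fun (f : T -> \bar R) x : measurable_fun setT f ->
  measurable [set w | f w = x].
Proof.
move=> mf; rewrite -[X in measurable X]setTI; apply: (mf measurableT [set x]).
exact: emeasurable_set1.
Qed.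

Lemma measurable_natvals (f : T -> \bar R) (U : set nat) :
  measurable_fun setT f ->
  measurable [set w | exists2 n, U n & f w = n%:R%:E].
Proof.
move=> mf; rewrite (_ : [set w | _] = \bigcup_(n in U) [set w | f w = n%:R%:E]).
  by apply: bigcup_measurable => n _; exact: measurable_eq_fun.
by apply/seteqP; split=> w [n Un fn]; exists n.
Qed.

End countable_intersections.

(** * Counting points *)

Section counting.
Context {R : realType}.

Lemma counting_setU (I : choiceType) (A B : set I) : A `&` B = set0 ->
  counting (A `|` B) = (counting A + counting B)%E :> \bar R.
Proof.
move=> AB0; rewrite /counting; have [fA|nA] := asboolP (finite_set A); last first.
  rewrite asboolF; last by rewrite finite_setU => -[].
  by rewrite addye //; case: ifP.
have [fB|nB] := asboolP (finite_set B); last first.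
  by rewrite asboolF ?addey //; rewrite finite_setU => -[].
rewrite asboolT ?finite_setU // fset_setU // cardfsU -fset_setI // AB0.
by rewrite fset_set0 cardfs0 subn0 natrD EFinD.
Qed.

Lemma counting_image (I J : choiceType) (f : I -> J) (A : set I) :
  injective f -> counting (f @` A) = counting A :> \bar R.
Proof.
move=> fI; rewrite /counting; have [fA|nA] := asboolP (finite_set A).
  rewrite asboolT; last exact: finite_image.
  by rewrite fset_set_image // card_imfset.
rewrite asboolF // => fA; apply: nA; rewrite -(@eq_finite_set _ _ (f @` A)) //.
by apply: inj_card_eq; exact: in2W.
Qed.

(** Splits a merged stream into the contributions of its sensors, by induction over a duplicate-free
    list of sensors. *)
Lemma counting_sections N (S : set ('I_N * nat)) :
  counting S = (\sum_(i < N) counting [set k | S (i, k)])%E :> \bar R.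
Proof.
have SE (s : seq 'I_N) : uniq s ->
    counting [set q | (q.1 \in s) /\ S q] =
    (\sum_(i <- s) counting [set k | S (i, k)])%E :> \bar R.
  elim: s => [_|i s IH /= /andP[is_ us]].
    rewrite big_nil (_ : [set q | _] = set0).
      by rewrite /counting asboolT // fset_set0.
    by apply/seteqP; split=> q // -[].
  rewrite big_cons -IH // -(@counting_image _ _ (pair i) [set k | S (i, k)]);
      last by move=> ? ? [].
  rewrite -counting_setU.
    congr counting; apply/seteqP; split=> [[a k] /=|q].
      rewrite inE => -[/orP[/eqP ->|sa]] Sq; [left|by right].
      by exists k.
    move=> [[k /= Sk <-]|[sq Sq]] /=; first by rewrite mem_head.
    by rewrite inE sq orbT.
  apply/seteqP; split=> q // -[[k /= _ <-]] [/= si _].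
  by rewrite si in is_.
rewrite -SE ?index_enum_uniq //; congr counting.
by apply/seteqP; split=> q; [move=> Sq; split=> //; rewrite mem_index_enum|case].
Qed.

Lemma counting_below n (p : pred nat) :
  counting [set k | (k < n)%N && p k] = (\sum_(k < n) p k)%N%:R%:E :> \bar R.
Proof.
elim: n => [|n IH].
  rewrite big_ord0 (_ : [set k | _] = set0) /counting ?asboolT ?fset_set0 //.
  by apply/seteqP; split=> k.
rewrite big_ord_recr /= natrD EFinD -IH.
rewrite (_ : (p n)%:R%:E = counting [set k | (k == n) && p k]); last first.
  case: (boolP (p n)) => pn.
    rewrite (_ : [set k | _] = [set n]).
      by rewrite /counting asboolT // fset_set1 cardfs1.
    by apply/seteqP; split=> k /=; [move=> /andP[/eqP]|move=> ->; rewrite eqxx].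
  rewrite (_ : [set k | _] = set0).
    by rewrite /counting asboolT // fset_set0.
  apply/seteqP; split=> k //= /andP[/eqP ->]; exact/negP.
rewrite -counting_setU.
  congr counting; apply/seteqP; split=> k /=.
    rewrite ltnS leq_eqVlt => /andP[/orP[kn|kn] pk]; [right|left]; exact/andP.
  move=> [|] /andP[kn ->]; rewrite andbT; first exact: (ltn_trans kn).
  by rewrite (eqP kn).
apply/seteqP; split=> k //= [/andP[kn _] /andP[/eqP kn' _]].
by rewrite kn' ltnn in kn.
Qed.

(* 0 when infinitely many terms are at most t. *)
Definition ncount (x : nat -> R) (t : R) : nat := #|` fset_set [set k | x k <= t]|.

(** For an ordered sequence the indices of the terms up to [t] form an initial segment, whose length
    is the least [n] with [t < x n]. *)
Lemma ncountP (x : nat -> R) t : (forall k, x k <= x k.+1) ->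
  finite_set [set k | x k <= t] -> forall k, (x k <= t) = (k < ncount x t)%N.
Proof.
move=> xS fx.
have xle k l : (k <= l)%N -> x k <= x l.
  move=> /subnK <-; elim: (l - k)%N => // n IH; exact: (le_trans IH (xS _)).
(* Otherwise every natural number would lie in the finite set of indices. *)
have ex : exists n, t < x n.
  apply: contrapT => /forallNP nx; apply: infinite_nat.
  rewrite (_ : setT = [set k | x k <= t]) //; apply/seteqP; split=> // k _ /=.
  by rewrite leNgt; apply/negP/nx.
case: (ex_minnP ex) => n tn min_n.
have DE k : (x k <= t) = (k < n)%N.
  apply/idP/idP => [xk|kn].
    rewrite ltnNge; apply/negP => /xle xnk.
    by move: tn; rewrite ltNge (le_trans xnk).
  by rewrite leNgt; apply/negP => /min_n; rewrite leqNgt kn.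
suff -> : ncount x t = n by [].
rewrite /ncount (_ : [set k | _] = `I_n); first exact/card_fset_set/card_eqxx.
by apply/seteqP; split=> k /=; rewrite DE.
Qed.

Lemma eq_ncount (x : nat -> R) t n :
  (forall k, (x k <= t) = (k < n)%N) -> ncount x t = n.
Proof.
move=> DE; rewrite /ncount (_ : [set k | _] = `I_n).
  exact/card_fset_set/card_eqxx.
by apply/seteqP; split=> k /=; rewrite DE.
Qed.

End counting.

(** * The packet system on a time grid *)

Section poisson_process_facts.
Context {d : measure_display} {T : measurableType d} {R : realType}.
Variables (P : probability T R) (rate : R) (N : R -> T -> \bar R).
Hypothesis pp : is_poisson_process P rate N.

Lemma poisson_process_start : P [set w | N 0 w = 0%E] = 1%E.
Proof.
have mS : measurable [set w | N 0 w = 0%E].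
  exact/measurable_eq_fun/(pp_measurable pp).
have : P (~` [set w | N 0 w = 0%E]) = 0%E.
  by apply/negligibleP; [exact: measurableC|exact: (pp_start pp)].
rewrite probability_setC // => P0; apply/eqP; rewrite eq_le probability_le1 //=.
by rewrite -sube_le0 P0.
Qed.

(** The increment law with [U := setT] makes the increment over [[0, t]] almost surely a natural
    number. *)
Lemma poisson_process_finite t : 0 <= t -> P [set w | N t w <> +oo%E] = 1%E.
Proof.
move=> t0; have mt := pp_measurable pp t0.
have m0 := pp_measurable pp (lexx 0).
have mF : measurable [set w | N t w <> +oo%E].
  by apply: measurableC; exact: measurable_eq_fun.
apply/eqP; rewrite eq_le probability_le1 //=.
have := pp_increment pp (lexx 0) t0 setT; rewrite probability_setT => <-.
apply: le_measure; rewrite ?inE //.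
  by apply: (@measurable_natvals _ _ _ (N t \- N 0)%E); exact: emeasurable_funB.
(* If [N t w] were infinite, the difference would be infinite for each possible [N 0 w], including
   [+oo - +oo], which evaluates to [-oo]. *)
by move=> w /= [n _] + Nt; rewrite Nt; case: (N 0 w).
Qed.

Lemma poisson_process_grid (s : nat -> R) (m : nat) (c : nat -> nat) :
  0 <= s 0%N -> (forall l, s l <= s l.+1) ->
  P [set w | forall l, l \in iota 0 m -> (N (s l.+1) w - N (s l) w)%E = (c l)%:R%:E] =
  (\prod_(l <- iota 0 m) pois (rate * (s l.+1 - s l)) (c l))%:E.
Proof.
move=> s0 sS.
have sl l : 0 <= s l by elim: l => // l IH; exact: (le_trans IH).
have mN l : measurable_fun setT (N (s l.+1) \- N (s l))%E.
  by apply: emeasurable_funB; exact: (pp_measurable pp).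
rewrite (mutual_indep_seq (pp_indep_increments pp s0 sS)
  (E := fun l => [set w | (N (s l.+1) w - N (s l) w)%E = (c l)%:R%:E])).
- rewrite -prodEFin; apply: eq_bigr => l _.
  rewrite -poisson_prob_set1; last first.
    by rewrite mulr_ge0 ?subr_ge0 // (pp_rate_ge0 pp).
  rewrite -(pp_increment pp (sl l) (sS l)); congr (P _).
  by apply/seteqP; split=> w /=; [exists (c l)|move=> [n ->]].
- exact: iota_uniq.
- move=> l _.
  have := (@sigma_gen_preimage _ _ _ _ _ 
    (fun _ : unit => (N (s l.+1) \- N (s l))%E) tt [set (c l)%:R%:E]
    (emeasurable_set1 _)).
  by [].
Qed.

End poisson_process_facts.

(** * Packet counts of the sensors and of the merged streams *)

Section packet_counts.
Context {R : realType} {d : measure_display} {T : measurableType d}.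
Variables (P : probability T R) (N M : nat).
Variables (lambda : 'I_N -> R) (p : 'M[R]_(N, M)).
Hypothesis hlambda : forall i, 0 < lambda i.
Hypothesis hp : forall i j, 0 <= p i j <= 1.
Variables (tau : 'I_N -> nat -> {RV P >-> R}).
Variables (C : 'I_N -> nat -> 'I_M -> {RV P >-> bool}).
Hypothesis hsys : packet_system lambda p tau C.
Variable j : 'I_M.

Definition sensor (i : 'I_N) : R -> T -> \bar R :=
  arrivals (fun _ => [set: nat]) (fun k => tau i k).

Definition stream (b : bool) : R -> T -> \bar R :=
  arrivals (fun w => [set q : 'I_N * nat | C q.1 q.2 j w == b])
           (fun q => tau q.1 q.2).

Definition nu (i : 'I_N) (t : R) (w : T) : nat := ncount (fun k => tau i k w) t.

(** Only integer times are tested, which keeps the intersection countable; finiteness at all other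
    times follows by monotonicity in time. *)
Definition good : set T :=
  [set w | forall i, forall n : nat, sensor i 0 w = 0%E /\ sensor i n%:R w <> +oo%E].

Lemma measurable_sensor i t : 0 <= t -> measurable_fun setT (sensor i t).
Proof. exact: (pp_measurable (ps_poisson hsys i)). Qed.

Lemma measurable_good : measurable good.
Proof.
apply: (measurable_bigcap_count (F := fun i => [set w | forall n : nat,
  sensor i 0 w = 0%E /\ sensor i n%:R w <> +oo%E])) => i.
apply: (measurable_bigcap_count (F := fun n : nat => [set w |
  sensor i 0 w = 0%E /\ sensor i n%:R w <> +oo%E])) => n.
apply: (measurableI [set w | sensor i 0 w = 0%E] [set w | sensor i n%:R w <> +oo%E]).
  exact/measurable_eq_fun/measurable_sensor.
by apply: measurableC; exact/measurable_eq_fun/measurable_sensor.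
Qed.

Lemma probability_good : P good = 1%E.
Proof.
have m0 i : measurable [set w | sensor i 0 w = 0%E].
  exact/measurable_eq_fun/measurable_sensor.
have mn i (n : nat) : measurable [set w | sensor i n%:R w <> +oo%E].
  by apply: measurableC; exact/measurable_eq_fun/measurable_sensor.
have mI i n := measurableI _ _ (m0 i) (mn i n).
apply: (probability_bigcap_count (F := fun i => [set w | forall n : nat,
  sensor i 0 w = 0%E /\ sensor i n%:R w <> +oo%E])) => i.
  exact: (measurable_bigcap_count (mI i)).
apply: (probability_bigcap_count (F := fun n : nat => [set w |
  sensor i 0 w = 0%E /\ sensor i n%:R w <> +oo%E])) => n.
  exact: mI.
apply: (probability_setI1 (m0 i) (mn i n)).
  exact: (poisson_process_start (ps_poisson hsys i)).
exact: (poisson_process_finite (ps_poisson hsys i) (ler0n _ _)).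
Qed.

Lemma sensorE i t w : sensor i t w = counting [set k | tau i k w <= t].
Proof. by rewrite /sensor /arrivals setTI. Qed.

Lemma good_finite w i t : good w -> finite_set [set k | tau i k w <= t].
Proof.
move=> Gw; have [n tn] : exists n : nat, t <= n%:R.
  by exists (Num.truncn t).+1; rewrite ltW // truncnS_gt.
have [_] := Gw i n; rewrite sensorE /counting.
have [fn _|//] := asboolP (finite_set _).
by apply: sub_finite_set fn => k /= /le_trans; apply.
Qed.

Lemma nuP w i t k : good w -> (tau i k w <= t) = (k < nu i t w)%N.
Proof.
move=> Gw; apply: (ncountP (x := fun k => tau i k w)); last exact: good_finite.
by move=> l; exact: (ps_ordered hsys).
Qed.

Lemma sensor_nu w i t : good w -> sensor i t w = (nu i t w)%:R%:E.
Proof. by move=> Gw; rewrite sensorE /counting asboolT //; exact: good_finite. Qed.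

Lemma nu0 w i : good w -> nu i 0 w = 0%N.
Proof.
move=> Gw; have [] := Gw i 0%N; rewrite (sensor_nu i 0 Gw) => -[] /eqP.
by rewrite pnatr_eq0 => /eqP.
Qed.

Lemma nu_le w i s t : good w -> s <= t -> (nu i s w <= nu i t w)%N.
Proof.
move=> Gw st; rewrite leqNgt; apply/negP => ts.
move: (ts); rewrite -(nuP i s) // => /le_trans/(_ st).
by rewrite nuP // ltnn.
Qed.

Lemma measurable_nu i t : 0 <= t -> measurable_fun setT (nu i t).
Proof.
move=> t0; apply/measurable_fun_natP => n.
have mE x := measurable_eq_fun x (measurable_sensor i t0).
pose D (w : T) := [set k | tau i k w <= t].
have D0 w : infinite_set (D w) -> nu i t w = 0%N.
  by move=> iD; rewrite /nu /ncount /fset_set; case: pselect.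
(* Where the count is infinite, [nu] takes the default value 0, so this event has to be added to the
   preimage of 0. *)
rewrite (_ : _ @^-1` _ = [set w | sensor i t w = n%:R%:E] `|`
    (if n == 0%N then [set w | sensor i t w = +oo%E] else set0)).
  by apply: measurableU => //; case: ifP.
apply/seteqP; split=> w; rewrite /= ?sensorE /counting.
  move=> <-; have [fD|iD] := asboolP (finite_set _); first by left.
  by right; rewrite D0 //= sensorE /counting asboolF.
have [fD|iD] := asboolP (finite_set _).
  case=> [[] /eqP|]; first by rewrite eqr_nat => /eqP.
  by case: ifP => // _; rewrite /= sensorE /counting asboolT.
case=> //; case: eqP => // -> _; exact: D0.
Qed.

Definition bit (b : bool) (q : 'I_N * nat) (w : T) : nat := C q.1 q.2 j w == b.

Lemma measurable_bit b q : measurable_fun setT (bit b q).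
Proof.
apply/measurable_fun_natP => n.
rewrite (_ : _ @^-1` _ = C q.1 q.2 j @^-1` [set y | (y == b) = n :> nat]) //.
by rewrite -[X in measurable X]setTI; exact: measurable_funPT.
Qed.

(** By [nuP], on [good] the summation range consists of the indices of the packets that sensor [i]
    generates after [s q.1] and up to [s q.1.+1]. *)
Definition incr (s : nat -> R) (i : 'I_N) (q : nat * bool) (w : T) : nat :=
  (\sum_(nu i (s q.1) w <= k < nu i (s q.1.+1) w) bit q.2 (i, k) w)%N.

Lemma measurable_incr s i q : (forall l, 0 <= s l) ->
  measurable_fun setT (incr s i q).
Proof.
move=> s0.
apply: (@measurable_fun_nat_comp _ _ (fun n w =>
  \sum_(n <= k < nu i (s q.1.+1) w) bit q.2 (i, k) w)%N); last exact: measurable_nu.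
move=> n; apply: (@measurable_fun_nat_comp _ _ (fun m w =>
  \sum_(n <= k < m) bit q.2 (i, k) w)%N); last exact: measurable_nu.
by move=> m; apply: measurable_fun_sumn => k; exact: measurable_bit.
Qed.

Lemma incr_true_false s i l w : good w -> s l <= s l.+1 ->
  (incr s i (l, true) w + incr s i (l, false) w =
   nu i (s l.+1) w - nu i (s l) w)%N.
Proof.
move=> Gw sl; rewrite /incr -big_split /= -[RHS]muln1 -sum_nat_const_nat.
apply: eq_bigr => k _.
by rewrite /bit; case: (C _ _ _ _).
Qed.

Lemma streamE b t w :
  stream b t w =
  (\sum_(i < N) counting [set k | (C i k j w == b) && (tau i k w <= t)%R])%E.
Proof.
rewrite /stream /arrivals counting_sections; apply: eq_bigr => i _.
by congr counting; apply/seteqP; split=> k /=; [case=> -> ->|move=> /andP].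
Qed.

Definition total (b : bool) (t : R) (w : T) : nat :=
  (\sum_(i < N) \sum_(k < nu i t w) bit b (i, k : nat) w)%N.

Lemma stream_total b t w : good w -> stream b t w = (total b t w)%:R%:E.
Proof.
move=> Gw; rewrite streamE /total natr_sum -sumEFin; apply: eq_bigr => i _.
rewrite -(counting_below (nu i t w) (fun k => C i k j w == b)).
by congr counting; apply/seteqP; split=> k /=; rewrite nuP // andbC.
Qed.

(** The index ranges of consecutive intervals concatenate, and on [good] there is no packet up to
    time [s 0 = 0]. *)
Lemma total_incr (s : nat -> R) b l w : good w -> s 0%N = 0 ->
  (forall l, s l <= s l.+1) ->
  total b (s l) w = (\sum_(k < l) \sum_(i < N) incr s i (k : nat, b) w)%N.
Proof.
move=> Gw s0 sS; elim: l => [|l IH].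
  by rewrite big_ord0 s0 /total big1 // => i _; rewrite nu0 // big_ord0.
rewrite big_ord_recr /= -IH /total -big_split /=; apply: eq_bigr => i _.
rewrite /incr /= -!(big_mkord xpredT (fun k => bit b (i, k) w)).
by rewrite [LHS](big_cat_nat (n := nu i (s l) w)) //= nu_le.
Qed.

(** Counting is a series of indicators, which gives measurability on the whole space and not only on
    [good]. *)
Lemma measurable_stream b t : measurable_fun setT (stream b t).
Proof.
rewrite (_ : stream b t = fun w =>
  (\sum_(i < N) counting [set k | (C i k j w == b) && (tau i k w <= t)%R])%E); last first.
  by apply/funext => w; exact: streamE.
apply: emeasurable_sum => i.
rewrite (_ : (fun w => counting _) = fun w =>
  (\sum_(k <oo) (\1_[set w | (C i k j w == b) && (tau i k w <= t)%R] w)%:E)%E).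
  apply: ge0_emeasurable_sum => [k w _ _|k _]; first by rewrite lee_fin.
  apply/measurable_EFinP; apply: measurable_indic.
  rewrite (_ : [set w | _] = (C i k j @^-1` [set b]) `&` (tau i k @^-1` `]-oo, t])).
    by apply: measurableI; exact: measurable_funPTI.
  apply/seteqP; split=> w; rewrite /= in_itv /=; first by move=> /andP[/eqP].
  by move=> [-> ->]; rewrite eqxx.
apply/funext => w; rewrite counting_dirac; apply: eq_eseriesr => k _.
by rewrite diracE indicE; congr (_%:R%:E); apply/idP/idP => /set_mem /mem_set.
Qed.


(* (l, true) and (l, false) stand for the packets in ]s_l, s_(l+1)] that do,
   respectively do not, contain information about process j. *)
Definition grid (m : nat) : seq (nat * bool) :=
  [seq (l, b) | l <- iota 0 m, b <- [:: true; false]].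

Definition full (m : nat) : seq ('I_N * (nat * bool)) :=
  [seq (i, q) | i <- enum 'I_N, q <- grid m].

(** * Joint law of the increments of all sensors *)

Definition prate (b : bool) (i : 'I_N) : R := if b then p i j else 1 - p i j.

Definition psum (c : nat -> nat) (l : nat) : nat := (\sum_(k < l) c k)%N.

Lemma psumS c l : psum c l.+1 = (psum c l + c l)%N.
Proof. by rewrite /psum big_ord_recr. Qed.

Lemma psum_le c k l : (k <= l)%N -> (psum c k <= psum c l)%N.
Proof.
move=> /subnK <-; elim: (l - k)%N => // n IH.
by rewrite addSn psumS (leq_trans IH) ?leq_addr.
Qed.

Lemma uniq_grid m : uniq (grid m).
Proof. by apply: allpairs_uniq; rewrite ?iota_uniq // => -[? ?] [? ?]. Qed.

Lemma uniq_full m : uniq (full m).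
Proof.
by apply: allpairs_uniq; rewrite ?enum_uniq ?uniq_grid // => -[? ?] [? ?].
Qed.

Lemma mem_grid m l b : ((l, b) \in grid m) = (l < m)%N.
Proof.
apply/allpairsP/idP => [[[l' b'] [/= lm _ [-> _]]]|lm].
  by move: lm; rewrite mem_iota.
by exists (l, b); split=> //=; [rewrite mem_iota|case: b].
Qed.

Lemma mem_full m i l b : ((i, (l, b)) \in full m) = (l < m)%N.
Proof.
apply/allpairsP/idP => [[[i' q'] [/= _ qm [_ qE]]]|lm].
  by move: qm; rewrite -qE mem_grid.
by exists (i, (l, b)); split=> //=; rewrite ?mem_enum ?mem_grid.
Qed.

(** Sensor [i] has [c l] packets in interval [l], expressed by comparing single generation times
    with the grid, so that membership in the sigma-algebra of the times is direct. The range [m.+1]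
    covers both ends of all [m] intervals. *)
Definition tau_event (s : nat -> R) (m : nat) (c : nat -> nat) (i : 'I_N) : set T :=
  [set w | forall l, l \in iota 0 m.+1 ->
    forall k, (tau i k w <= s l) = (k < psum c l)%N].

Lemma tau_event_nu s m c i w : good w ->
  tau_event s m c i w <-> (forall l, (l <= m)%N -> nu i (s l) w = psum c l).
Proof.
move=> Gw; split=> [tw l lm|nw l].
  by apply: (eq_ncount (x := fun k => tau i k w)); apply: tw; rewrite mem_iota.
by rewrite mem_iota => lm k; rewrite nuP // nw.
Qed.

Lemma sigma_gen_tau_event s m c i :
  sigma_gen (fun k => tau i k : T -> R) (tau_event s m c i).
Proof.
have sH := sigma_gen_algebra (fun k => tau i k : T -> R).
apply: (sigma_algebra_bigcap_seq sH (F := fun l => [set w |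
  forall k, (tau i k w <= s l) = (k < psum c l)%N])) => l _.
apply: (sigma_algebra_bigcap_count sH (F := fun k : nat => [set w |
  (tau i k w <= s l) = (k < psum c l)%N])) => k.
have Hk : sigma_gen (fun k => tau i k : T -> R) [set w | tau i k w <= s l].
  rewrite (_ : [set w | _] = (tau i k : T -> R) @^-1` `]-oo, s l]).
    exact: (@sigma_gen_preimage _ _ _ _ _ (fun k => tau i k : T -> R) k _
      (measurable_itv _)).
  by apply/seteqP; split=> w; rewrite /= in_itv.
case: (k < _)%N => //.
rewrite (_ : [set w | _] = ~` [set w | tau i k w <= s l]).
  exact: (sigma_algebra_setC sH).
by apply/seteqP; split=> w /=; [move=> ->|move/negP/negbTE].
Qed.

Lemma measurable_tau_event s m c i : measurable (tau_event s m c i).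
Proof.
apply: (sigma_gen_measurable (X := fun k => tau i k : T -> R)).
  by move=> k; exact: measurable_funPT.
exact: sigma_gen_tau_event.
Qed.

(** On [good] the count at [s 0 = 0] vanishes, so prescribing the counts at the grid points is the
    same as prescribing the Poisson increments. *)
Lemma probability_tau_event s m c i : s 0%N = 0 -> (forall l, s l <= s l.+1) ->
  P (tau_event s m c i) =
  (\prod_(l <- iota 0 m) pois (lambda i * (s l.+1 - s l)) (c l))%:E.
Proof.
move=> s0 sS; rewrite -(poisson_process_grid (ps_poisson hsys i)) ?s0 //.
have sl l : 0 <= s l by elim: l => [|l IH]; [rewrite s0|exact: (le_trans IH)].
apply: (eq_probability_as measurable_good probability_good).
- exact: measurable_tau_event.
- apply: (sigma_algebra_bigcap_seq (@sigma_algebra_measurable _ T) (F := fun l =>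
    [set w | (sensor i (s l.+1) w - sensor i (s l) w)%E = (c l)%:R%:E])) => l _.
  apply: (@measurable_eq_fun _ _ _ (sensor i (s l.+1) \- sensor i (s l))%E).
  by apply: emeasurable_funB; exact: measurable_sensor.
- move=> w Gw; rewrite tau_event_nu //; split=> [nw l|dw].
    rewrite mem_iota add0n => lm.
    rewrite -!/(sensor i _) !sensor_nu // !nw //; last exact: ltnW.
    by rewrite psumS -EFinB natrD addrAC subrr add0r.
  elim=> [_|l IH lm]; first by rewrite s0 nu0 // /psum big_ord0.
  have := dw l; rewrite mem_iota add0n => /(_ lm).
  rewrite -!/(sensor i _) !sensor_nu // -EFinB => -[] /eqP.
  by rewrite subr_eq -natrD eqr_nat => /eqP ->; rewrite IH ?psumS 1?addnC // ltnW.
Qed.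

(** Given the totals [c], the packets of sensor [i] in interval [l] occupy a deterministic range of
    indices; each range is paired with its prescribed number of informative packets. *)
Definition content_blocks (m : nat) (c : 'I_N -> nat -> nat)
    (a : 'I_N * (nat * bool) -> nat) : seq (seq ('I_N * nat) * nat) :=
  [seq ([seq (il.1, k) | k <- index_iota (psum (c il.1) il.2) (psum (c il.1) il.2.+1)],
        a (il.1, (il.2, true)))
   | il <- [seq (i, l) | i <- enum 'I_N, l <- iota 0 m]].

(** Since [psum] is monotone, the ranges of different intervals of one sensor are disjoint. *)
Lemma uniq_content_blocks m c a : uniq (flatten (unzip1 (content_blocks m c a))).
Proof.
rewrite /unzip1 /content_blocks -map_comp.
apply: (@allpairs_uniq_dep _ (fun=> nat) _ (fun il k => (il.1, k))).
- by apply: allpairs_uniq; rewrite ?enum_uniq ?iota_uniq // => -[? ?] [? ?].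
- by move=> il _; exact: iota_uniq.
move=> _ _ /allpairsPdep[[i l] [k [_ kl ->]]] /allpairsPdep[[i' l'] [k' [_ kl' ->]]].
move=> /= [ii kk]; move: kl kl'; rewrite -{}ii -{}kk {i' k'} !mem_index_iota /=.
move=> /andP[lk kl] /andP[lk' kl'].
suff -> : l = l' by [].
apply/eqP; rewrite eqn_leq; apply/andP; split; rewrite leqNgt; apply/negP => ll.
- have := leq_trans (leq_trans kl' (psum_le (c i) ll)) lk; by rewrite ltnn.
- have := leq_trans (leq_trans kl (psum_le (c i) ll)) lk'; by rewrite ltnn.
Qed.

Lemma probability_bits s0 (a : 'I_N * nat -> nat) : uniq s0 ->
  P (joint_eq (bit true) s0 a) = (\prod_(q <- s0) bern (p q.1 j) (a q))%:E.
Proof.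
move=> us0; pose E q := bit true q @^-1` [set a q].
rewrite (_ : joint_eq _ _ _ = [set w | forall q, q \in s0 -> E q w]); last first.
  apply/seteqP; split=> w.
    by move=> /allP aw q /aw /eqP.
  by move=> Ew; apply/allP => q /Ew ->.
have iC : mutual_indep P (fun q : 'I_N * nat =>
    sigma_gen (fun _ : unit => C q.1 q.2 j : T -> bool)).
  exact: (ps_indep_packets hsys).
rewrite (mutual_indep_seq iC us0); last first.
  move=> q _; rewrite (_ : E q = (C q.1 q.2 j : T -> bool) @^-1`
    [set y | (y == true) = a q :> nat]) //.
  exact: (@sigma_gen_preimage _ _ _ _ _ (fun _ : unit => C q.1 q.2 j : T -> bool) tt).
rewrite -prodEFin; apply: eq_bigr => q _.
have PC : P [set w | C q.1 q.2 j w] = (p q.1 j)%:E := ps_content hsys q.1 q.2 j.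
have mC : measurable [set w | C q.1 q.2 j w].
  rewrite (_ : [set w | _] = C q.1 q.2 j @^-1` [set true]); last by apply/seteqP; split.
  exact: measurable_funPTI.
rewrite /E /bern; case: (a q) => [|[|n]] /=.
- rewrite EFinB -PC -probability_setC //; congr (P _).
  by apply/seteqP; split=> w; rewrite /bit /=; case: (C _ _ _ _).
- rewrite mul1r -PC; congr (P _).
  by apply/seteqP; split=> w; rewrite /bit /=; case: (C _ _ _ _).
- rewrite mul0r (_ : _ @^-1` _ = set0) ?measure0 //.
  by apply/seteqP; split=> w; rewrite /bit /=; case: (C _ _ _ _).
Qed.

(** The contents are independent Bernoulli variables, so the sum over the block of length [c i l] is
    binomial. *)
Lemma probability_content m c a :
  P (block_eq (bit true) (content_blocks m c a)) =
  (\prod_(i <- enum 'I_N) \prod_(l <- iota 0 m)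
    ('C(c i l, a (i, (l, true)))%:R * p i j ^+ a (i, (l, true)) *
     (1 - p i j) ^+ (c i l - a (i, (l, true)))))%:E.
Proof.
have us0 := uniq_content_blocks m c a.
have := probability_block_sums (measurable_bit true)
  (g := fun q => bern (p q.1 j)) us0 (fun a' => probability_bits a' us0)
  (bl := content_blocks m c a) (xs := [::]) (fun=> 0%N) (perm_refl _).
rewrite big_nil mul1r (_ : _ `&` _ = block_eq (bit true) (content_blocks m c a)).
  move=> ->; congr _%:E; rewrite big_map big_allpairs.
  apply: eq_bigr => i _; apply: eq_bigr => l _ /=.
  rewrite conv_map /= (conv_bern (p i j)) size_iota psumS.
  by rewrite addKn.
by apply/seteqP; split=> w; [case|split].
Qed.

Lemma sigma_gen_content m c a :
  sigma_gen (fun q : 'I_N * nat => C q.1 q.2 j : T -> bool)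
    (block_eq (bit true) (content_blocks m c a)).
Proof.
set H := sigma_gen _; have sH : sigma_algebra setT H by exact: sigma_gen_algebra.
have Hbit q n : H (bit true q @^-1` [set n]).
  exact: (@sigma_gen_preimage _ _ _ _ _
    (fun q : 'I_N * nat => C q.1 q.2 j : T -> bool) q
    [set y | (y == true) = n :> nat]).
exact: sigma_algebra_block_eq.
Qed.

(** Separates contents from times: once the totals are fixed, the random index ranges in [incr]
    become the deterministic ranges of [content_blocks]. *)
Lemma joint_incr_events s m a w : good w -> s 0%N = 0 ->
  (forall l, s l <= s l.+1) ->
  let c i l := (a (i, (l, true)) + a (i, (l, false)))%N in
  joint_eq (fun x => incr s x.1 x.2) (full m) a w <->
  block_eq (bit true) (content_blocks m c a) w /\
  (forall i, i \in enum 'I_N -> tau_event s m (c i) i w).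
Proof.
move=> Gw s0 sS c.
have blockE : (forall i l, (l <= m)%N -> nu i (s l) w = psum (c i) l) ->
    block_eq (bit true) (content_blocks m c a) w <->
    (forall i l, (l < m)%N -> incr s i (l, true) w = a (i, (l, true))).
  move=> nw; have E i l : (l < m)%N ->
      (\sum_(x <- [seq (i, k) | k <- index_iota (psum (c i) l) (psum (c i) l.+1)])
        bit true x w)%N = incr s i (l, true) w.
    by move=> lm; rewrite big_map /incr /= !nw // ltnW.
  split=> [/allP bw i l lm|iw].
    rewrite -E //; apply/eqP.
    apply: (bw (_, _)); apply/mapP; exists (i, l) => //.
    by apply/allpairsP; exists (i, l); rewrite mem_enum mem_iota.
  apply/allP => _ /mapP[_ /allpairsP[[i l] [/= _ lm ->]] ->] /=.
  by rewrite mem_iota in lm; rewrite E // iw.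
split=> [/allP iw|[bw tw]].
  have iE i l b : (l < m)%N -> incr s i (l, b) w = a (i, (l, b)).
    by move=> lm; apply/eqP; apply: (iw (i, (l, b))); rewrite mem_full.
  (* The counts at the grid points are recovered by induction from zero, adding informative and
     non-informative packets. *)
  have nw i l : (l <= m)%N -> nu i (s l) w = psum (c i) l.
    elim: l => [|l IH] lm; first by rewrite s0 nu0 // /psum big_ord0.
    have := incr_true_false i Gw (sS l); rewrite !iE // => ce.
    rewrite psumS -IH; last exact: ltnW.
    by rewrite /c ce subnKC // nu_le.
  split; first by apply/blockE => // i l; exact: iE.
  by move=> i _; apply/tau_event_nu => // l; exact: nw.
have nw i l : (l <= m)%N -> nu i (s l) w = psum (c i) l.
  by move=> lm; move/(tau_event_nu s m (c i) i Gw): (tw i (mem_enum _ i)); apply.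
move/(blockE nw): bw => iw.
apply/allP => -[i [l b]]; rewrite mem_full => lm /=; case: b; first by rewrite iw.
(* The non-informative count is the prescribed total minus the informative count. *)
have := incr_true_false i Gw (sS l); rewrite iw // !nw // 1?ltnW // psumS addKn.
by move=> /addnI ->.
Qed.

(** The event splits into a content event [B] and a time event [D], which are independent; [D]
    factors over the sensors. *)
Lemma probability_joint_incr s m a : s 0%N = 0 -> (forall l, s l <= s l.+1) ->
  P (joint_eq (fun x => incr s x.1 x.2) (full m) a) =
  (\prod_(x <- full m) pois (prate x.2.2 x.1 *
     (lambda x.1 * (s x.2.1.+1 - s x.2.1))) (a x))%:E.
Proof.
move=> s0 sS; pose c i l := (a (i, (l, true)) + a (i, (l, false)))%N.
have sl l : 0 <= s l by elim: l => [|l IH]; [rewrite s0|exact: (le_trans IH)].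
set B := block_eq (bit true) (content_blocks m c a).
set D := [set w | forall i, i \in enum 'I_N -> tau_event s m (c i) i w].
have sD : sigma_gen (fun q : 'I_N * nat => tau q.1 q.2 : T -> R) D.
  have sH := sigma_gen_algebra (fun q : 'I_N * nat => tau q.1 q.2 : T -> R).
  apply: (sigma_algebra_bigcap_seq sH (F := fun i => tau_event s m (c i) i)) => i _.
  suff sub : sigma_gen (fun k => tau i k : T -> R) `<=`
      sigma_gen (fun q : 'I_N * nat => tau q.1 q.2 : T -> R).
    by apply: sub; exact: sigma_gen_tau_event.
  apply: (sigma_gen_min sH) => k A mA.
  exact: (@sigma_gen_preimage _ _ _ _ _
    (fun q : 'I_N * nat => tau q.1 q.2 : T -> R) (i, k)).
have mB : measurable B by apply: measurable_block_eq => q; exact: measurable_bit.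
have mD : measurable D.
  apply: (sigma_algebra_bigcap_seq (@sigma_algebra_measurable _ T)
    (F := fun i => tau_event s m (c i) i)) => i _.
  exact: measurable_tau_event.
rewrite (@eq_probability_as _ _ _ P good _ (B `&` D)); first last.
- by move=> w Gw; exact: joint_incr_events.
- exact: measurableI.
- by apply: measurable_joint_eq => x; exact: measurable_incr.
- exact: probability_good.
- exact: measurable_good.
have iCt : indep2 P (sigma_gen (fun q : 'I_N * nat => C q.1 q.2 j : T -> bool))
    (sigma_gen (fun q : 'I_N * nat => tau q.1 q.2 : T -> R)).
  exact: (ps_indep_content_times hsys).
rewrite iCt //; last exact: sigma_gen_content.
rewrite probability_content (mutual_indep_seq (ps_indep_sensors hsys)); first last.
- by move=> i _; exact: sigma_gen_tau_event.
- exact: enum_uniq.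
rewrite [X in (_ * X)%E](eq_bigr (fun i => (\prod_(l <- iota 0 m)
  pois (lambda i * (s l.+1 - s l)) (c i l))%:E)); last first.
  by move=> i _; exact: probability_tau_event.
(* Binomial and Poisson weights are paired for each sensor and interval, where [pois_thin]
   applies. *)
rewrite prodEFin -EFinM -big_split /=; congr _%:E.
rewrite big_allpairs; apply: eq_bigr => i _.
rewrite -big_split big_allpairs; apply: eq_bigr => l _ /=.
rewrite !big_cons big_nil mulr1 /= /prate /c addKn mulrC.
exact: pois_thin.
Qed.

(** * Increments of the merged streams on a grid *)

Definition srate (b : bool) : R := \sum_(i < N) prate b i * lambda i.

Definition sincr (s : nat -> R) (q : nat * bool) (w : T) : nat :=
  (\sum_(i < N) incr s i q w)%N.

Lemma prate_ge0 b i : 0 <= prate b i.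
Proof. by case: b; rewrite /prate ?subr_ge0; have /andP[] := hp i j. Qed.

Lemma srate_ge0 b : 0 <= srate b.
Proof. by apply: sumr_ge0 => i _; rewrite mulr_ge0 ?prate_ge0 // ltW. Qed.

Lemma grid_time_ge0 (s : nat -> R) : s 0%N = 0 -> (forall l, s l <= s l.+1) ->
  forall l, 0 <= s l.
Proof. by move=> s0 sS; elim=> [|l IH]; [rewrite s0|exact: (le_trans IH)]. Qed.

Lemma measurable_sincr s q : (forall l, 0 <= s l) ->
  measurable_fun setT (sincr s q).
Proof. by move=> s0; apply: measurable_fun_sumn => i; exact: measurable_incr. Qed.

Section time_grid.
Variable s : nat -> R.
Hypotheses (s0 : s 0%N = 0) (sS : forall l, s l <= s l.+1).
Let sl : forall l, 0 <= s l := grid_time_ge0 s0 sS.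

Definition grid_rate (q : nat * bool) : R := srate q.2 * (s q.1.+1 - s q.1).

Lemma grid_rate_ge0 q : 0 <= grid_rate q.
Proof. by rewrite mulr_ge0 ?srate_ge0 // subr_ge0. Qed.

Lemma probability_joint_sincr m a :
  P (joint_eq (sincr s) (grid m) a) =
  (\prod_(q <- grid m) pois (grid_rate q) (a q))%:E.
Proof.
(* One block per interval and stream, running over all sensors; [conv_pois] then adds the rates. *)
pose bl := [seq ([seq (i, q) | i <- enum 'I_N], a q) | q <- grid m].
have mX x : measurable_fun setT (incr s x.1 x.2) by exact: measurable_incr.
have blP : perm_eq ([::] ++ flatten (unzip1 bl)) (full m).
  rewrite /= /unzip1 /bl -map_comp; apply: uniq_perm; last first.
  - move=> x; apply/allpairsP/allpairsP => -[[u v] [/= ? ? ->]];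
      by exists (v, u).
  - exact: uniq_full.
  - apply: allpairs_uniq; rewrite ?enum_uniq ?uniq_grid // => -[? ?] [? ?].
    by move=> _ _ [-> ->].
have := probability_block_sums mX
  (g := fun x => pois (prate x.2.2 x.1 * (lambda x.1 * (s x.2.1.+1 - s x.2.1))))
  (uniq_full m) (fun a' => probability_joint_incr m a' s0 sS) (fun=> 0%N) blP.
rewrite big_nil mul1r (_ : _ `&` _ = joint_eq (sincr s) (grid m) a).
  move=> ->; congr _%:E; rewrite big_map; apply: eq_bigr => q _ /=.
  rewrite conv_pois big_map big_enum /=; congr pois.
  by rewrite /grid_rate mulr_suml; apply: eq_bigr => i _; rewrite mulrA.
apply/seteqP; split=> w; rewrite /joint_eq /block_eq /=.
  move=> [_ /allP bw]; apply/allP => q qm.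
  have := bw _ (map_f (fun q => ([seq (i, q) | i <- enum 'I_N], a q)) qm).
  by rewrite /= big_map big_enum.
move=> /allP sw; split=> //; apply/allP => _ /mapP[q qm ->] /=.
by rewrite big_map big_enum /=; exact: sw.
Qed.

Lemma probability_sincr_sets m (U : nat * bool -> set nat) :
  P [set w | forall q, q \in grid m -> U q (sincr s q w)] =
  (\prod_(q <- grid m) fine (poisson_prob (grid_rate q) 0 (U q)))%:E.
Proof.
have mX q : measurable_fun setT (sincr s q) by exact: measurable_sincr.
pose mu q : probability nat R := poisson_prob (grid_rate q) 0.
have H a : P (joint_eq (sincr s) (grid m) a) =
    (\prod_(q <- grid m) fine (mu q [set a q]))%:E.
  rewrite probability_joint_sincr; congr _%:E; apply: eq_bigr => q _.
  by rewrite /mu /= poisson_prob_set1 ?grid_rate_ge0.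
have := probability_joint_preimage mX (uniq_grid m) H U
  (ys := grid m) (xs := [::]) (fun=> 0%N) (perm_refl _).
rewrite big_nil mul1r => <-; congr (P _).
by apply/seteqP; split=> w; [split|case].
Qed.

Lemma fine_poisson_probT r : fine (poisson_prob r 0 setT) = 1 :> R.
Proof. by rewrite probability_setT. Qed.

(** Marginal law of one stream: the other one is constrained by [setT] only and contributes factors
    1. *)
Lemma probability_sincr_stream b m (V : nat -> set nat) :
  P [set w | forall l, l \in iota 0 m -> V l (sincr s (l, b) w)] =
  (\prod_(l <- iota 0 m) fine (poisson_prob (grid_rate (l, b)) 0 (V l)))%:E.
Proof.
have := probability_sincr_sets m (fun q => if q.2 == b then V q.1 else setT).
rewrite big_allpairs (_ : [set w | _] =
    [set w | forall l, l \in iota 0 m -> V l (sincr s (l, b) w)]).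
  move=> ->; congr _%:E; apply: eq_bigr => l _.
  by rewrite !big_cons big_nil /=; case: b; rewrite /= fine_poisson_probT ?mul1r !mulr1.
apply/seteqP; split=> w Vw.
  move=> l; rewrite mem_iota add0n => lm.
  by have := Vw (l, b); rewrite mem_grid eqxx; apply.
move=> [l b'] /=; rewrite mem_grid => lm; case: eqP => // ->.
by apply: Vw; rewrite mem_iota.
Qed.

Lemma probability_sincr b l (V : set nat) :
  P [set w | V (sincr s (l, b) w)] = poisson_prob (grid_rate (l, b)) 0 V.
Proof.
have := probability_sincr_stream b l.+1 (fun k => if k == l then V else setT).
rewrite (_ : [set w | forall k, _] = [set w | V (sincr s (l, b) w)]).
  move=> ->; rewrite (bigD1_seq l) ?iota_uniq ?mem_iota //= eqxx.
  rewrite big1 ?mulr1; last by move=> k /negbTE ->; rewrite fine_poisson_probT.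
  by rewrite fineK // fin_num_measure.
apply/seteqP; split=> w Vw.
  by have := Vw l; rewrite mem_iota add0n leqnn eqxx; apply.
by move=> k _; case: eqP => [->|].
Qed.

Lemma stream_sincr b l w : good w ->
  stream b (s l) w = (\sum_(k < l) sincr s (k : nat, b) w)%N%:R%:E.
Proof. by move=> Gw; rewrite stream_total // total_incr. Qed.

Lemma stream_increment b l w : good w ->
  (stream b (s l.+1) w - stream b (s l) w)%E = (sincr s (l, b) w)%:R%:E.
Proof.
move=> Gw; rewrite !stream_sincr // big_ord_recr /= -EFinB natrD.
by rewrite addrAC subrr add0r.
Qed.

Definition increments (m : nat) (b : bool) (w : T) : seq nat :=
  [seq sincr s (l, b) w | l <- iota 0 m].

Lemma increments_eq m b w v : size v = m ->
  increments m b w = v <->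
  (forall l, l \in iota 0 m -> [set nth 0%N v l] (sincr s (l, b) w)).
Proof.
move=> sv; split=> [<- l lm|vw].
  move: lm; rewrite mem_iota add0n /= => lm.
  by rewrite (nth_map 0%N) ?size_iota // nth_iota.
apply: (@eq_from_nth _ 0%N); first by rewrite size_map size_iota sv.
move=> l; rewrite size_map size_iota => lm.
rewrite (nth_map 0%N) ?size_iota // nth_iota // add0n.
by apply: vw; rewrite mem_iota.
Qed.

Lemma probability_increments m (v : bool -> seq nat) : (forall b, size (v b) = m) ->
  P [set w | forall b, increments m b w = v b] =
  (P [set w | increments m true w = v true] *
   P [set w | increments m false w = v false])%E.
Proof.
move=> sv.
have E b : P [set w | increments m b w = v b] = (\prod_(l <- iota 0 m)
    fine (poisson_prob (grid_rate (l, b)) 0 [set nth 0%N (v b) l]))%:E.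
  rewrite -probability_sincr_stream; congr (P _).
  by apply/seteqP; split=> w /=; rewrite (increments_eq b w (sv b)).
rewrite !E -EFinM -big_split /=.
have := probability_sincr_sets m (fun q => [set nth 0%N (v q.2) q.1]).
rewrite (_ : [set w | forall q, _] = [set w | forall b, increments m b w = v b]).
  move=> ->; congr _%:E; rewrite big_allpairs; apply: eq_bigr => l _.
  by rewrite !big_cons big_nil /= mulr1.
apply/seteqP; split=> w /= vw.
  move=> b; apply/increments_eq => // l.
  by rewrite mem_iota => lm; apply: (vw (l, b)); rewrite mem_grid.
move=> [l b]; rewrite mem_grid => lm.
by have /(increments_eq b w (sv b)) := vw b; apply; rewrite mem_iota.
Qed.

Lemma measurable_increments m b v : measurable [set w | increments m b w = v].
Proof.
have [sv|sv] := eqVneq (size v) m; last first.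
  rewrite (_ : [set w | _] = set0) //; apply/seteqP; split=> w //= vE.
  by move: sv; rewrite -vE size_map size_iota eqxx.
rewrite (_ : [set w | _] = [set w | forall l, l \in iota 0 m ->
    [set nth 0%N v l] (sincr s (l, b) w)]).
  apply: (sigma_algebra_bigcap_seq (@sigma_algebra_measurable _ T) (F := fun l =>
    sincr s (l, b) @^-1` [set nth 0%N v l])) => l _.
  by apply: measurable_preimage_nat; exact: measurable_sincr.
by apply/seteqP; split=> w /=; rewrite (increments_eq b w sv).
Qed.

(** Coding the countable type [seq nat] in [nat] makes the results on natural-number variables
    available for whole vectors of increments. *)
Lemma measurable_increments_pickle m b :
  measurable_fun setT (choice.pickle \o increments m b).
Proof.
apply/measurable_fun_natP => n.
have [[v vn]|nv] := pselect (exists v : seq nat, choice.pickle v = n).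
  rewrite (_ : _ @^-1` _ = [set w | increments m b w = v]).
    exact: measurable_increments.
  apply/seteqP; split=> w /=; last by move=> ->.
  by rewrite -vn => /(pcan_inj choice.pickleK).
rewrite (_ : _ @^-1` _ = set0) //; apply/seteqP; split=> w //= vE.
by apply: nv; exists (increments m b w).
Qed.

Lemma increments_pickle m b (V : set (seq nat)) :
  [set w | V (increments m b w)] =
  (choice.pickle \o increments m b) @^-1` (choice.pickle @` V).
Proof.
apply/seteqP; split=> w /=; first by exists (increments m b w).
by move=> [v Vv /(pcan_inj choice.pickleK) <-].
Qed.

Lemma measurable_increments_set m b (V : set (seq nat)) :
  measurable [set w | V (increments m b w)].
Proof.
rewrite increments_pickle; apply: measurable_preimage_nat.
exact: measurable_increments_pickle.
Qed.

Lemma indep_increments m (V W : set (seq nat)) :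
  P ([set w | V (increments m true w)] `&` [set w | W (increments m false w)]) =
  (P [set w | V (increments m true w)] * P [set w | W (increments m false w)])%E.
Proof.
rewrite !increments_pickle; apply: indep_nat_preimage.
- exact: measurable_increments_pickle.
- exact: measurable_increments_pickle.
(* A code either represents a list of length [m] or is never attained; in the second case both sides
   of the product formula are zero. *)
have H b n : (exists2 v, size v = m & (choice.pickle \o increments m b) @^-1` [set n]
      = [set w | increments m b w = v]) \/
    (choice.pickle \o increments m b) @^-1` [set n] = set0.
  have [[v [vn sv]]|nv] :=
    pselect (exists v : seq nat, choice.pickle v = n /\ size v = m).
    left; exists v => //; apply/seteqP; split=> w /=; last by move=> ->.
    by rewrite -vn => /(pcan_inj choice.pickleK).
  right; apply/seteqP; split=> w //= vE; apply: nv.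
  by exists (increments m b w); rewrite size_map size_iota.
move=> k l; have [[v sv ->]|->] := H true k; last by rewrite set0I !measure0 mul0e.
have [[v' sv' ->]|->] := H false l; last by rewrite setI0 !measure0 mule0.
have := @probability_increments m (fun b : bool => if b then v else v').
move=> <-; last by case.
congr (P _); apply/seteqP; split=> w; first by move=> [vE v'E] [].
by move=> vw; split; [exact: (vw true)|exact: (vw false)].
Qed.

End time_grid.

(** * The merged streams as independent Poisson processes *)

Lemma stream_start b : {ae P, forall w, stream b 0 w = 0%E}.
Proof.
exists (~` good); split.
- exact: measurableC measurable_good.
- by rewrite probability_setC ?probability_good ?subee //; exact: measurable_good.
apply: subsetC => w Gw /=; rewrite stream_total // /total big1 // => i _.
by rewrite nu0 // big_ord0.
Qed.

Lemma stream_increment_law b u t : 0 <= u -> u <= t -> forall U : set nat,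
  P [set w | exists2 n, U n & (stream b t w - stream b u w)%E = n%:R%:E] =
  poisson_prob (srate b * (t - u)) 0 U.
Proof.
move=> u0 ut U.
(* The grid 0, u, t, t, ..., whose interval of index 1 is the one from [u] to [t]. *)
pose s (n : nat) : R := if n is n'.+1 then (if n' is 0%N then u else t) else 0.
have sS l : s l <= s l.+1 by case: l => [|[|l]] /=.
rewrite -(@probability_sincr s erefl sS b 1 U).
apply: (eq_probability_as measurable_good probability_good).
- apply: (@measurable_natvals _ _ _ (stream b t \- stream b u)%E).
  by apply: emeasurable_funB; exact: measurable_stream.
- apply: (@measurable_preimage_nat _ _ (sincr s (1%N, b))).
  by apply: measurable_sincr; exact: grid_time_ge0.
move=> w Gw /=; have := stream_increment (s := s) erefl sS b 1 Gw; rewrite /= => ->.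
split=> [[n Un [] /eqP]|Us]; last by exists (sincr s (1%N, b) w).
by rewrite eqr_nat => /eqP ->.
Qed.

Lemma stream_indep_increments b (t : nat -> R) :
  0 <= t 0%N -> (forall n, t n <= t n.+1) ->
  mutual_indep P
    (fun n => sigma_gen (fun _ : unit => (stream b (t n.+1) \- stream b (t n))%E)).
Proof.
move=> t0 tS J E EJ.
(* Grids start at 0, so 0 is put in front and interval [n] of [t] becomes interval [n.+1] of [s]. *)
pose s (n : nat) : R := if n is n'.+1 then t n' else 0.
have sS l : s l <= s l.+1 by case: l.
have /boolp.choice[B BE] n : exists Bn : set (\bar R), n \in J -> measurable Bn /\
    E n = (stream b (t n.+1) \- stream b (t n))%E @^-1` Bn.
  have [nJ|nJ] := boolP (n \in J); last by exists set0.
  by have [A mA EA] := sigma_gen_unit (EJ n nJ); exists A.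
pose V n := [set k : nat | B n k%:R%:E].
have mE n : n \in J -> measurable (E n).
  move=> nJ; have [mB ->] := BE n nJ; rewrite -[X in measurable X]setTI.
  by apply: emeasurable_funB => //; exact: measurable_stream.
have EV n w : n \in J -> good w -> E n w <-> V n (sincr s (n.+1, b) w).
  move=> nJ Gw; have [_ ->] := BE n nJ; rewrite /V /=.
  by have := stream_increment (s := s) erefl sS b n.+1 Gw; rewrite /= => ->.
have PE n : n \in J -> P (E n) = P [set w | V n (sincr s (n.+1, b) w)].
  move=> nJ; apply: (eq_probability_as measurable_good probability_good).
  - exact: mE.
  - apply: (@measurable_preimage_nat _ _ (sincr s (n.+1, b))).
    by apply: measurable_sincr; exact: grid_time_ge0.
  - by move=> w; exact: EV.
(* The finite set [J] is embedded in an initial segment; [V'] leaves the intervals outside [J]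
   unconstrained. *)
pose m := (\max_(n <- J) n).+1.
have Jm n : n \in J -> (n < m)%N by move=> nJ; rewrite ltnS; exact: leq_bigmax_seq.
pose V' l := if l is n.+1 then (if n \in J then V n else setT) else setT.
have := @probability_sincr_stream s erefl sS b m.+1 V'.
rewrite (@eq_probability_as _ _ _ P good _ (\bigcap_(n in [set` J]) E n)); first last.
- move=> w Gw; split=> [Vw n /= nJ|Ew l lm].
    apply/EV => //; have := Vw n.+1; rewrite /V' nJ; apply.
    by rewrite mem_iota add0n /= ltnS; exact: Jm.
  case: l lm => [//|n] lm; rewrite /V'; case: ifP => // nJ.
  by apply/EV => //; exact: Ew.
- by apply: fin_bigcap_measurable => // n /=; exact: mE.
- apply: (sigma_algebra_bigcap_seq (@sigma_algebra_measurable _ T) (F := fun l =>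
    sincr s (l, b) @^-1` V' l)) => l _.
  apply: measurable_preimage_nat.
  by apply: measurable_sincr; exact: grid_time_ge0.
- exact: probability_good.
- exact: measurable_good.
move=> ->; rewrite (_ : iota 0 m.+1 = 0%N :: map S (iota 0 m)); last first.
  by rewrite -(iotaDl 1 0 m).
rewrite big_cons big_map /V' fine_poisson_probT mul1r -prodEFin.
transitivity (\prod_(n <- iota 0 m | n \in J) P (E n))%E.
  rewrite [RHS]big_mkcond /=; apply: eq_bigr => n _; case: ifP => nJ.
    rewrite PE // (@probability_sincr s erefl sS) fineK //.
    by rewrite fin_num_measure.
  by rewrite fine_poisson_probT.
rewrite -big_filter; apply: perm_big; apply: uniq_perm.
- by rewrite filter_uniq // iota_uniq.
- exact: fset_uniq.
by move=> n; rewrite mem_filter mem_iota /= add0n andb_idr //; exact: Jm.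
Qed.

Lemma stream_poisson b : is_poisson_process P (srate b) (stream b).
Proof.
split.
- exact: srate_ge0.
- by move=> t _; exact: measurable_stream.
- exact: stream_start.
- exact: stream_increment_law.
- exact: stream_indep_increments.
Qed.

Lemma indep_streams : indep_processes P (stream true) (stream false).
Proof.
pose X b (t : {t : R | 0 <= t}) := stream b (val t).
have mX b t : measurable_fun setT (X b t) by exact: measurable_stream.
suff : indep2 P (cylinders (X true)) (cylinders (X false)).
  move=> /(indep2_generated (cylinders_measurable (mX true))
    (cylinders_measurable (mX false)) (@setI_closed_cylinders _ _ _ _ _ (X true))
    (@setI_closed_cylinders _ _ _ _ _ (X false))).
  by apply: indep2_sub; exact: sigma_gen_cylinders.
move=> _ _ [cs1 m1 <-] [cs2 m2 <-].
(* All times occurring in either cylinder are sorted behind 0 into one common grid, which [minn]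
   keeps constant after its last point. *)
pose ts := [seq c.1 | c <- cs1 ++ cs2].
pose st := sort <=%R [seq val t | t <- ts].
pose s (n : nat) : R := nth 0 (0 :: st) (minn n (size st)).
have st_sorted : sorted <=%R (0 :: st).
  rewrite /= path_sortedE; last exact: le_trans.
  rewrite sort_le_sorted andbT; apply/allP => x.
  by rewrite mem_sort => /mapP[t _ ->]; exact: (valP t).
have sS l : s l <= s l.+1.
  apply: (sorted_leq_nth le_trans lexx 0 st_sorted);
    rewrite ?inE /= ?ltnS ?geq_minr //.
  by rewrite leq_min geq_minr (leq_trans (geq_minl _ _)).
have s0 : s 0%N = 0 by rewrite /s min0n.
pose m := size st.
(* The shift by one accounts for the leading 0. *)
pose pos (t : {t : R | 0 <= t}) := (index (val t) st).+1.
have s_pos t : t \in ts -> s (pos t) = val t /\ (pos t <= m)%N.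
  move=> tts; have tst : val t \in st by rewrite mem_sort map_f.
  have lt : (pos t <= m)%N by rewrite /pos /m index_mem.
  by split=> //; rewrite /s (minn_idPl lt) /= nth_index.
(* A stream's value at [t] is a partial sum of its increments, so each cylinder becomes a condition
   on one vector and [indep_increments] applies. *)
pose Y (t : {t : R | 0 <= t}) (v : seq nat) : \bar R :=
  (\sum_(k < pos t) nth 0%N v k)%N%:R%:E.
have XY b w t : good w -> t \in ts -> X b t w = Y t (increments s m b w).
  move=> Gw tts; have [st_t tm] := s_pos t tts.
  rewrite /X -st_t (@stream_sincr s s0 sS) // /Y; congr _%:R%:E.
  apply: eq_bigr => k _; have km := leq_trans (ltn_ord k) tm.
  by rewrite (nth_map 0%N) ?size_iota // nth_iota.
have PX b cs : measurable_constraints cs -> all (fun c => c.1 \in ts) cs ->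
    measurable (cylinder (X b) cs) /\ (forall w, good w ->
    cylinder (X b) cs w <-> cylinder Y cs (increments s m b w)).
  move=> mcs cts; split; last first.
    move=> w Gw.
    by rewrite (@cylinder_comp _ _ _ _ ts _ Y (increments s m b)) // => t; exact: XY.
  by apply: (cylinders_measurable (mX b)); exists cs.
have c1 : all (fun c => c.1 \in ts) cs1.
  rewrite -(all_map (@fst _ _) (mem ts)); apply/allP => t tcs /=.
  by rewrite /ts map_cat mem_cat tcs.
have c2 : all (fun c => c.1 \in ts) cs2.
  rewrite -(all_map (@fst _ _) (mem ts)); apply/allP => t tcs /=.
  by rewrite /ts map_cat mem_cat tcs orbT.
have [mc1 e1] := PX true cs1 m1 c1; have [mc2 e2] := PX false cs2 m2 c2.
have mI b cs : measurable [set w | cylinder Y cs (increments s m b w)].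
  exact: measurable_increments_set.
have eqP1 := eq_probability_as measurable_good probability_good mc1 (mI true cs1) e1.
have eqP2 := eq_probability_as measurable_good probability_good mc2 (mI false cs2) e2.
rewrite [X in (X * _)%E]eqP1 [X in (_ * X)%E]eqP2.
rewrite -(@indep_increments s s0 sS).
apply: (eq_probability_as measurable_good probability_good).
- exact: measurableI.
- exact: measurableI.
by move=> w Gw; split=> -[/(e1 w Gw) ? /(e2 w Gw)].
Qed.

End packet_counts.

Theorem lemma1 (R : realType) (d : measure_display) (T : measurableType d)
  (P : probability T R) (N M : nat) (hN : (1 <= N)%N) (hM : (1 <= M)%N)
  (lambda : 'I_N -> R) (hlambda : forall i, 0 < lambda i)
  (p : 'M[R]_(N, M)) (hp : forall i j, 0 <= p i j <= 1)
  (tau : 'I_N -> nat -> {RV P >-> R})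
  (C : 'I_N -> nat -> 'I_M -> {RV P >-> bool})
  (hsys : packet_system lambda p tau C) (j : 'I_M) :
  let lambdaC := \sum_(i < N) lambda i in
  let lambdaS := \sum_(i < N) p i j * lambda i in
  [/\ is_poisson_process P lambdaS (arrivals_with tau C j),
      is_poisson_process P (lambdaC - lambdaS) (arrivals_without tau C j)
    & indep_processes P (arrivals_with tau C j) (arrivals_without tau C j)].
Proof.
move=> lambdaC lambdaS.
have withE : arrivals_with tau C j = stream tau C j true.
  apply/funext => t; apply/funext => w; rewrite /arrivals_with /stream /arrivals.
  by congr (counting (_ `&` _)); apply/seteqP; split=> q /=; rewrite eqb_id.
have withoutE : arrivals_without tau C j = stream tau C j false.
  apply/funext => t; apply/funext => w; rewrite /arrivals_without /stream /arrivals.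
  by congr (counting (_ `&` _)); apply/seteqP; split=> q /=; rewrite eqbF_neg.
have rateE : lambdaC - lambdaS = srate lambda p j false.
  rewrite /srate /lambdaC /lambdaS -sumrB; apply: eq_bigr => i _.
  by rewrite mulrBl mul1r.
rewrite withE withoutE rateE; split.
- exact: (stream_poisson hlambda hp hsys j true).
- exact: (stream_poisson hlambda hp hsys j false).
- exact: (indep_streams hlambda hp hsys).
Qed.
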